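(* (Inversion formula.) Let $R$ be a commutative ring with unit, $n\ge0$, and let $\mathcal S_n$ be the strong category of $n$-fold filtered $R$-modules built from the finite $R$-modules. The Fourier transformations $$\mathbb F:\mathcal E_n\to\tilde{\mathcal E}_n'\circ\hat\cdot\,,\qquad \tilde{\mathbb F}':\tilde{\mathcal E}_n'\to\mathcal E_n\circ\hat\cdot$$ are inverse to each other, in the sense that there are canonical isomorphisms $\mathbb F\tilde{\mathbb F}'(\tilde{\mathcal E}_n')\cong\tilde{\mathcal E}_n'$ and $\tilde{\mathbb F}'\mathbb F(\mathcal E_n)\cong\mathcal E_n$. In the same sense, $\mathbb F':\mathcal E_n'\to\tilde{\mathcal E}_n\circ\hat\cdot$ and $\tilde{\mathbb F}:\tilde{\mathcal E}_n\to\mathcal E_n'\circ\hat\cdot$ are inverses of each other. (Here, for $A\in\mathcal S_n$, $\tilde{\mathbb F}'\mathbb F$ on $\mathcal E_n(A)$ is the composite $\mathcal E_n(A)\to\tilde{\mathcal E}_n'(\hat A)\to\mathcal E_n(\hat{\hat A})$, and similarly for the other composites.)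
   Context: Filtrations. A partially ordered set is filtering if any two elements have a lower bound and an upper bound in it. A filtration on an object $A$ of an abelian category $\mathcal A$ is, up to natural isomorphism, a family of subobjects $F(i)\subset A$ indexed by a filtering partially ordered set $I_F$ with $F(i)\subset F(j)$ for $i\le j$, $\bigcap_iF(i)=0$, $\bigcup_iF(i)=A$. An order preserving map $\phi:I\to J$ of filtering sets is cofinal if for every $j\in J$ there are $i_1,i_2\in I$ with $\phi(i_1)\le j\le\phi(i_2)$. A sub-filtration of $F$ is a pair $(\phi,S)$ with $\phi:I_S\to I_F$ cofinal and $S$ a filtration with $S\cong F\circ\phi$. Let $\sim$ be the equivalence relation generated by $F\sim S$ whenever $S$ is a sub-filtration of $F$; $[F]$ is the class of $F$. All filtrations have countable index set. The categories $\mathcal A_n$. Here $\mathcal A$ is the category of $R$-modules and $\mathcal A_0$ the full subcategory of modules that are finite as sets. Objects $A$ of $\mathcal A_0$ are regarded as trivially filtered ($I_F=\{0,\infty\}$, $F(0)=0$, $F(\infty)=A$). For $n\ge1$, an object of $\mathcal A_n$ is a class $(A,[F])$ of filtrations together with a class of filtrations $[E_{i,j}]$ on $F(j)/F(i)$ for all $i\le j$, such that $(F(j)/F(i),[E_{i,j}])$ is an object of $\mathcal A_{n-1}$ and the natural maps $F(i)/F(j)\to F(k)/F(l)$ ($j\le i$, $l\le k$, $k\ge i$, $l\ge j$) are morphisms in $\mathcal A_{n-1}$. A morphism $(A,[F])\to(B,[G])$ in $\mathcal A_n$ is a morphism $\phi:A\to B$ in $\mathcal A$ such that for every $i\in I_F$,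 $j\in I_G$ there exist $i_0\le i$, $j_0\ge j$ such that for all $i'\le i_0$, $j'\ge j_0$ one has $\phi(F(i'))\subset G(j)$, $\phi(F(i))\subset G(j')$, and the induced map $F(i)/F(i')\to G(j')/G(j)$ is a morphism in $\mathcal A_{n-1}$. The strong categories. A kernel is a map which is the kernel of its cokernel; a cokernel is a map which is the cokernel of its kernel. A sequence $0\to A\xrightarrow{\alpha}B\xrightarrow{\beta}C\to0$ in $\mathcal A_n$ is exact if $\alpha$ is the kernel of $\beta$ and $\beta$ the cokernel of $\alpha$. A morphism $\phi$ in $\mathcal A_n$ is quasi-strong if the canonical map $\operatorname{coker}(\ker\phi)\to\ker(\operatorname{coker}\phi)$ is an isomorphism; equivalently it is a cokernel followed by a kernel (uniquely up to isomorphism). Put $\mathcal S_0=\mathcal A_0$. For $n\ge1$, $(A,[F])$ in $\mathcal A_n$ is strong if for all $i\le j$ the quotient $F(j)/F(i)$ is strong in $\mathcal A_{n-1}$ and for all $i\le j\le k$ the sequence $F(j)/F(i)\to F(k)/F(i)\to F(k)/F(j)$ is exact in $\mathcal A_{n-1}$. A morphism is strong if it is quasi-strong with strong source and target. $\mathcal S_n$ is the category of strong objects and strong morphisms. For $i\le j\le k$ let $\alpha_{ijk}:F(j)/F(i)\to F(k)/F(i)$ and $\pi_{ijk}:F(k)/F(i)\to F(k)/F(j)$ be the natural maps. Dual. For $n=0$, $\hat A=\operatorname{Hom}_{\mathbb Z}(A,\mathbb Q/\mathbb Z)$ with $(r\alpha)(a)=\alpha(ra)$. For $n>0$, $\hat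 A=\varinjlim_i\varprojlim_j\widehat{F(j)/F(i)}$, with filtration $\hat F(i)=\varprojlim_j\widehat{F(j)/F(i)}$ indexed by $I_F$ with the opposite order; one has $\hat F(i)/\hat F(j)=\widehat{F(j)/F(i)}$ for $i\le j$. This is a contravariant functor on $\mathcal S_n$, and there is a natural map $\delta:A\to\hat{\hat A}$ (evaluation for $n=0$, limits of such for $n>0$). Function spaces. For a set $A$ let $C(A)$ be the space of all maps $A\to\mathbb C$. For $\phi:A\to B$ let $\phi^*(f)=f\circ\phi$, and for finite $A,B$ let $\phi_*(f)(x)=\sum_{y:\phi(y)=x}f(y)$. For $A\in\mathcal S_0$ put $\mathcal E_0(A)=\tilde{\mathcal E}_0(A)=C(A)$ (contravariant via $\phi^*$), $\mathcal E_0'(A)=\tilde{\mathcal E}_0'(A)=C(A)$ (covariant via $\phi_*$). For $n>0$ and $(A,[F])\in\mathcal S_n$: $\mathcal E_n(A)=\varprojlim_j\varinjlim_i\mathcal E_{n-1}(F(j)/F(i))$, $\tilde{\mathcal E}_n(A)=\varinjlim_i\varprojlim_j\tilde{\mathcal E}_{n-1}(F(j)/F(i))$ (limits with respect to $\pi_{ijk}^*$, $\alpha_{ijk}^*$), $\mathcal E_n'(A)=\varinjlim_j\varprojlim_i\mathcal E_{n-1}'(F(j)/F(i))$, $\tilde{\mathcal E}_n'(A)=\varprojlim_i\varinjlim_j\tilde{\mathcal E}_{n-1}'(F(j)/F(i))$ (limits with respect to $(\pi_{ijk})_*$, $(\alpha_{ijk})_*$). For a kernel or cokernel $\phi:(A,[F])\to(B,[G])$,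 with the filtrations chosen induced one by the other, $\phi^*$ and $\phi_*$ are the limits of the maps for $\phi_{ij}:F(j)/F(i)\to G(j)/G(i)$; for general strong morphisms compose. Fourier transforms. For $A\in\mathcal S_0$, $f\in C(A)$, $\alpha\in\hat A$: $\mathbb F f(\alpha)=\tilde{\mathbb F}f(\alpha)=\frac1{|A|}\sum_{a\in A}f(a)e^{-2\pi i\alpha(a)}$ and $\mathbb F'f(\alpha)=\tilde{\mathbb F}'f(\alpha)=\sum_{a\in A}f(a)e^{2\pi i\alpha(a)}$. For $n>0$ the maps $\mathbb F:\mathcal E_n(A)\to\tilde{\mathcal E}_n'(\hat A)$, $\mathbb F':\mathcal E_n'(A)\to\tilde{\mathcal E}_n(\hat A)$, $\tilde{\mathbb F}:\tilde{\mathcal E}_n(A)\to\mathcal E_n'(\hat A)$, $\tilde{\mathbb F}':\tilde{\mathcal E}_n'(A)\to\mathcal E_n(\hat A)$ are obtained by taking limits of the corresponding maps for the quotients $F(j)/F(i)$, whose duals are $\hat F(i)/\hat F(j)$. These are natural transformations of functors (e.g. $\mathbb F\circ\phi^*=\hat\phi_*\circ\mathbb F$ for strong $\phi$). *)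

(* Defs.v *)
From HB Require Import structures.
From mathcomp Require Import all_boot all_order all_algebra generic_quotient.
From mathcomp Require Import ring_quotient.
From mathcomp Require Import finmap.
From mathcomp Require Import boolp classical_sets functions cardinality reals.
From mathcomp Require Import trigo.
From mathcomp Require Import complex.

Set Implicit Arguments.
Unset Strict Implicit.
Unset Printing Implicit Defensive.

Import Order.TTheory GRing.Theory Num.Theory.
Local Open Scope classical_set_scope.
Local Open Scope ring_scope.

(* A diagram of K-modules indexed by the d with [dact d], with a map
   dmod d -> dmod e whenever [darr d e].  The fields are total for convenience:
   what they are at indices that are not active, or at pairs that are not
   arrows, plays no role. *)
Record diagram (K : pzRingType) := Diagram {
  didx : Type;
  dact : didx -> Prop;
  darr : didx -> didx -> Prop;
  dmod : didx -> lmodType K;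
  dmap : forall d e, {linear dmod d -> dmod e} }.

Definition dedge (K : pzRingType) (G : diagram K) (d e : didx G) : Prop :=
  [/\ dact d, dact e & darr d e].

Section Limit.
Variables (K : pzRingType) (G : diagram K).

(* Compatible families; a family is required to vanish at the inactive
   indices so that equality of families only concerns the active ones. *)
Record lim := Lim {
  lim_fam :> forall d : didx G, dmod d;
  lim_map : forall d e, dedge d e -> dmap d e (lim_fam d) = lim_fam e;
  lim_out : forall d, ~ dact d -> lim_fam d = 0 }.

HB.instance Definition _ := gen_eqMixin lim.
HB.instance Definition _ := gen_choiceMixin lim.

Lemma limP (f g : lim) : (forall d, f d = g d) -> f = g.
Proof.
case: f g => [f f1 f2] [g g1 g2] /= fg.
have E : f = g by apply: functional_extensionality_dep.
by subst g; congr Lim; exact: Prop_irrelevance.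
Qed.

Program Definition lim_zero := @Lim (fun=> 0) _ _.
Next Obligation. by move=> d e _; rewrite linear0. Qed.
Next Obligation. by []. Qed.
Program Definition lim_opp (f : lim) := @Lim (fun d => - f d) _ _.
Next Obligation. by move=> f d e h /=; rewrite linearN (lim_map f h). Qed.
Next Obligation. by move=> f d h /=; rewrite (lim_out f h) oppr0. Qed.
Program Definition lim_add (f g : lim) := @Lim (fun d => f d + g d) _ _.
Next Obligation. by move=> f g d e h /=; rewrite linearD (lim_map f h) (lim_map g h). Qed.
Next Obligation. by move=> f g d h /=; rewrite (lim_out f h) (lim_out g h) addr0. Qed.
Program Definition lim_scale (a : K) (f : lim) := @Lim (fun d => a *: f d) _ _.
Next Obligation. by move=> a f d e h /=; rewrite linearZ (lim_map f h). Qed.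
Next Obligation. by move=> a f d h /=; rewrite (lim_out f h) scaler0. Qed.

Fact lim_addA : associative lim_add.
Proof. by move=> f g h; apply: limP => d /=; rewrite addrA. Qed.
Fact lim_addC : commutative lim_add.
Proof. by move=> f g; apply: limP => d /=; rewrite addrC. Qed.
Fact lim_add0 : left_id lim_zero lim_add.
Proof. by move=> f; apply: limP => d /=; rewrite add0r. Qed.
Fact lim_addN : left_inverse lim_zero lim_opp lim_add.
Proof. by move=> f; apply: limP => d /=; rewrite addNr. Qed.
HB.instance Definition _ :=
  GRing.isZmodule.Build lim lim_addA lim_addC lim_add0 lim_addN.

Fact lim_scaleA a b f : lim_scale a (lim_scale b f) = lim_scale (a * b) f.
Proof. by apply: limP => d /=; rewrite scalerA. Qed.
Fact lim_scale1 : left_id 1 lim_scale.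
Proof. by move=> f; apply: limP => d /=; rewrite scale1r. Qed.
Fact lim_scaleDr : right_distributive lim_scale +%R.
Proof. by move=> a f g; apply: limP => d /=; rewrite scalerDr. Qed.
Fact lim_scaleDl f : {morph lim_scale^~ f : a b / a + b}.
Proof. by move=> a b; apply: limP => d /=; rewrite scalerDl. Qed.
HB.instance Definition _ := GRing.Zmodule_isLmodule.Build K lim
  lim_scaleA lim_scale1 lim_scaleDr lim_scaleDl.

Definition lim_proj (d : didx G) (f : lim) : dmod d := f d.
Fact lim_proj_linear d : linear (lim_proj d).
Proof. by []. Qed.
HB.instance Definition _ d :=
  GRing.isLinear.Build K lim (dmod d) *:%R (lim_proj d) (lim_proj_linear d).

End Limit.

Section Colimit.
Variables (K : pzRingType) (G : diagram K).

Record cocone := Cocone {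
  apex : lmodType K;
  leg : forall d : didx G, {linear dmod d -> apex};
  leg_map : forall d e, dedge d e -> forall x, leg e (dmap d e x) = leg d x;
  leg_out : forall d, ~ dact d -> forall x, leg d x = 0 }.

(* Formal sums of elements of the modules of the diagram.  The colimit is
   their quotient by the relation "no cocone distinguishes s and t", which is
   the one generated by linearity and by x = dmap d e x. *)
Definition fsum := seq {d : didx G & dmod d}.
HB.instance Definition _ := gen_eqMixin fsum.
HB.instance Definition _ := gen_choiceMixin fsum.

Definition fsum_eval (c : cocone) (s : fsum) : apex c :=
  \sum_(p <- s) leg c (tag p) (tagged p).

Definition fsum_eq (s t : fsum) : bool :=
  `[< forall c, fsum_eval c s = fsum_eval c t >].

Fact fsum_eq_equiv : equiv_class_of fsum_eq.
Proof.
split=> [s|s t|t s u]; first exact/asboolP.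
  by apply/asboolP/asboolP => h c; rewrite h.
by move=> /asboolP h /asboolP h'; apply/asboolP => c; rewrite h.
Qed.
Canonical fsum_equiv := EquivRelPack fsum_eq_equiv.

Definition colim := {eq_quot fsum_eq}%qT.
HB.instance Definition _ := Choice.on colim.

Definition colim_class (s : fsum) : colim := \pi_{eq_quot fsum_eq}%qT s.

Definition colim_eval (c : cocone) (x : colim) : apex c :=
  fsum_eval c (repr (x : {eq_quot fsum_eq}%qT)).

Lemma colim_eval_class c s : colim_eval c (colim_class s) = fsum_eval c s.
Proof.
rewrite /colim_eval /colim_class.
have /eqmodP/asboolP : (repr (\pi_({eq_quot fsum_eq}) s)%qT
  = s %[mod {eq_quot fsum_eq}])%qT by rewrite reprK.
by move/(_ c).
Qed.

Lemma colimP (x y : colim) : (forall c, colim_eval c x = colim_eval c y) -> x = y.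
Proof.
move=> h; rewrite -[x](@reprK _ {eq_quot fsum_eq}%qT).
rewrite -[y](@reprK _ {eq_quot fsum_eq}%qT).
by apply/eqmodP/asboolP => c; exact: h.
Qed.

Definition fsum_scale (a : K) (s : fsum) : fsum :=
  [seq Tagged (fun d => dmod d : Type) (a *: tagged p : dmod (tag p)) | p <- s].

Definition colim_zero : colim := colim_class [::].
Definition colim_scale a (x : colim) : colim :=
  colim_class (fsum_scale a (repr (x : {eq_quot fsum_eq}%qT))).
Definition colim_add (x y : colim) : colim :=
  colim_class (repr (x : {eq_quot fsum_eq}%qT)
               ++ repr (y : {eq_quot fsum_eq}%qT)).
Definition colim_opp (x : colim) : colim := colim_scale (-1) x.

Fact colim_eval0 c : colim_eval c colim_zero = 0.
Proof. by rewrite colim_eval_class /fsum_eval big_nil. Qed.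
Fact colim_evalD c x y :
  colim_eval c (colim_add x y) = colim_eval c x + colim_eval c y.
Proof. by rewrite colim_eval_class /fsum_eval big_cat. Qed.
Fact colim_evalZ c a x : colim_eval c (colim_scale a x) = a *: colim_eval c x.
Proof.
rewrite colim_eval_class /colim_eval /fsum_eval big_map scaler_sumr.
by apply: eq_bigr => p _ /=; rewrite linearZ.
Qed.
Definition colim_evalE := (colim_eval0, colim_evalD, colim_evalZ).

Fact colim_addA : associative colim_add.
Proof. by move=> x y z; apply: colimP => c; rewrite !colim_evalE addrA. Qed.
Fact colim_addC : commutative colim_add.
Proof. by move=> x y; apply: colimP => c; rewrite !colim_evalE addrC. Qed.
Fact colim_add0 : left_id colim_zero colim_add.
Proof. by move=> x; apply: colimP => c; rewrite !colim_evalE add0r. Qed.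
Fact colim_addN : left_inverse colim_zero colim_opp colim_add.
Proof. by move=> x; apply: colimP => c; rewrite !colim_evalE scaleN1r addNr. Qed.
HB.instance Definition _ :=
  GRing.isZmodule.Build colim colim_addA colim_addC colim_add0 colim_addN.

Fact colim_scaleA a b x : colim_scale a (colim_scale b x) = colim_scale (a * b) x.
Proof. by apply: colimP => c; rewrite !colim_evalE scalerA. Qed.
Fact colim_scale1 : left_id 1 colim_scale.
Proof. by move=> x; apply: colimP => c; rewrite !colim_evalE scale1r. Qed.
Fact colim_scaleDr : right_distributive colim_scale +%R.
Proof. by move=> a x y; apply: colimP => c; rewrite !colim_evalE scalerDr. Qed.
Fact colim_scaleDl x : {morph colim_scale^~ x : a b / a + b}.
Proof. by move=> a b; apply: colimP => c; rewrite !colim_evalE scalerDl. Qed.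
HB.instance Definition _ := GRing.Zmodule_isLmodule.Build K colim
  colim_scaleA colim_scale1 colim_scaleDr colim_scaleDl.

Definition colim_in (d : didx G) (x : dmod d) : colim :=
  colim_class [:: Tagged (fun d => dmod d : Type) x].
Fact colim_in_linear d : linear (@colim_in d).
Proof.
move=> a x y; apply: colimP => c; rewrite colim_evalD colim_evalZ !colim_eval_class.
by rewrite /fsum_eval !big_seq1 /= linearP.
Qed.
HB.instance Definition _ d := GRing.isLinear.Build K (dmod d) colim *:%R
  (@colim_in d) (@colim_in_linear d).

Lemma colim_in_map d e (x : dmod d) :
  dedge d e -> colim_in (dmap d e x) = colim_in x.
Proof.
move=> h; apply: colimP => c.
by rewrite !colim_eval_class /fsum_eval !big_seq1 /= leg_map.
Qed.

Lemma colim_in_out d (x : dmod d) : ~ dact d -> colim_in x = 0.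
Proof.
move=> h; apply: colimP => c; rewrite colim_eval0.
by rewrite colim_eval_class /fsum_eval big_seq1 leg_out.
Qed.

Fact colim_eval_linear c : linear (colim_eval c).
Proof. by move=> a x y; rewrite colim_evalD colim_evalZ. Qed.
HB.instance Definition _ c := GRing.isLinear.Build K colim (apex c) *:%R
  (colim_eval c) (colim_eval_linear c).

Lemma colim_eval_in c d (x : dmod d) : colim_eval c (colim_in x) = leg c d x.
Proof. by rewrite colim_eval_class /fsum_eval big_seq1. Qed.

End Colimit.

Arguments colim_in {K G} d.
Arguments lim_proj {K G} d.

(* The linear map characterised by P (and 0 if there is none).  It is applied
   below to compatibility conditions that, on the objects of interest, pin down
   a unique map between limits and colimits: the limit of a family of maps. *)
Definition the_linear (K : pzRingType) (U V : lmodType K)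
    (P : {linear U -> V} -> Prop) : {linear U -> V} :=
  if pselect (exists f, P f) is left h then projT1 (cid h) else \0.

(* Modules M_ij for i <= j, with maps M_kl -> M_ij for i <= k and j <= l.
   The value of the fields at other indices plays no role. *)
Record bisys (K : pzRingType) := Bisys {
  bidx : Type;
  ble : bidx -> bidx -> Prop;
  bmod : bidx -> bidx -> lmodType K;
  bmap : forall i j k l, {linear bmod k l -> bmod i j} }.

Section IteratedLimits.
Variable K : pzRingType.
Implicit Type M : bisys K.

(* For fixed j: the system (M_ij) for i <= j, with i decreasing. *)
Definition col_diag M (j : bidx M) : diagram K :=
  @Diagram K (bidx M) (fun i => ble i j) (fun i i' => ble i' i)
    (fun i => bmod i j) (fun i i' => bmap i' j i j).

(* For fixed i: the system (M_ij) for j >= i, with maps M_il -> M_ij, j <= l. *)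
Definition row_diag M (i : bidx M) : diagram K :=
  @Diagram K (bidx M) (fun j => ble i j) (fun l j => ble j l)
    (fun j => bmod i j) (fun l j => bmap i j i l).

(* For j <= k: the map colim_{i <= k} M_ik -> colim_{i <= j} M_ij induced by the
   M_ik -> M_ij, i <= j; the i <= j are cofinal among the i <= k. *)
Definition col_map M (k j : bidx M) :
    {linear colim (col_diag k) -> colim (col_diag j)} :=
  the_linear (fun T => forall i (x : bmod i k), ble i j ->
    T (@colim_in _ (col_diag k) i x) = @colim_in _ (col_diag j) i (bmap i j i k x)).

(* For i <= k: the map lim_{j >= k} M_kj -> lim_{j >= i} M_ij induced by the
   M_kj -> M_ij, j >= k. *)
Definition row_map M (k i : bidx M) :
    {linear lim (row_diag k) -> lim (row_diag i)} :=
  the_linear (fun T : {linear lim (row_diag k) -> lim (row_diag i)} =>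
    forall (f : lim (row_diag k)) j, ble k j -> (T f) j = bmap i j k j (f j)).

Definition limcolim_diag M : diagram K :=
  @Diagram K (bidx M) (fun=> True) (fun k j => ble j k)
    (fun j => colim (col_diag j)) (fun k j => col_map k j).
Definition colimlim_diag M : diagram K :=
  @Diagram K (bidx M) (fun=> True) (fun k i => ble i k)
    (fun i => lim (row_diag i)) (fun k i => row_map k i).

(* lim_j colim_i M_ij  and  colim_i lim_j M_ij *)
Definition limcolim M : lmodType K := lim (limcolim_diag M).
Definition colimlim M : lmodType K := colim (colimlim_diag M).

(* Components of a morphism N -> M: a set of maps N_ij -> M_i'k for each
   i', k (indices of M) and i, j (indices of N). *)
Definition components (N M : bisys K) :=
  forall (i' k : bidx M) (i j : bidx N), set {linear bmod i j -> bmod i' k}.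

Definition limcolim_map (N M : bisys K) (c : components N M) :
    {linear limcolim N -> limcolim M} :=
  the_linear (fun T : {linear limcolim N -> limcolim M} =>
    forall (f : lim (limcolim_diag N)) i' k i j u (x : bmod i j),
    ble i' k -> ble i j -> c i' k i j u ->
    f j = @colim_in _ (col_diag j) i x ->
    (T f : lim (limcolim_diag M)) k = @colim_in _ (col_diag k) i' (u x)).

Definition colimlim_map (N M : bisys K) (c : components N M) :
    {linear colimlim N -> colimlim M} :=
  the_linear (fun T : {linear colimlim N -> colimlim M} =>
    forall i (f : lim (row_diag i)) i' (g : lim (row_diag i')),
    (forall k, ble i' k ->
       exists j, ble i j /\ exists2 u, c i' k i j u & g k = u (f j)) ->
    T (@colim_in _ (colimlim_diag N) i f) = @colim_in _ (colimlim_diag M) i' g).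

Inductive flavour := LimColim | ColimLim.

Definition ilim (o : flavour) M : lmodType K :=
  match o with LimColim => limcolim M | ColimLim => colimlim M end.

Definition ilim_map (o : flavour) N M (c : components N M) :
    {linear ilim o N -> ilim o M} :=
  match o with LimColim => limcolim_map c | ColimLim => colimlim_map c end.

End IteratedLimits.

(* Only the data: no category or functor laws are imposed in this record and in
   [cofunctor] (contravariant), [functor] (covariant), [duality]. *)
Record modcat (R : pzRingType) := Modcat {
  mob : Type;
  mhom : mob -> mob -> Type;
  mmod : mob -> lmodType R;
  mlin : forall X Y, mhom X Y -> {linear mmod X -> mmod Y} }.

Record cofunctor (R K : pzRingType) (C : modcat R) := Cofunctor {
  cob : mob C -> lmodType K;
  cmap : forall X Y : mob C, mhom X Y -> {linear cob Y -> cob X} }.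
Record functor (R K : pzRingType) (C : modcat R) := Functor {
  vob : mob C -> lmodType K;
  vmap : forall X Y : mob C, mhom X Y -> {linear vob X -> vob Y} }.

Section Filtered.
Variables (R : pzRingType) (C : modcat R).

(* The object (A, [F]) is presented by a representative F of the class of
   filtrations (and likewise for the quotients); equivalent filtrations give
   objects that are isomorphic through the identity of A.

   A module A = fmod with a family F(i) = fsub i of subobjects (given by maps
   finc), and for i <= j an object fquo i j of C whose module is F(j)/F(i), by
   means of the quotient map fprj i j.  The natural maps
   F(j)/F(i) -> F(l)/F(k), for i <= k and j <= l, are part of the data; on the
   objects of A_n they are forced, see [isobj]. *)
Record filtered := Filtered {
  fmod : lmodType R;
  fdisp : Order.disp_t;
  fidx : porderType fdisp;
  fsub : fidx -> lmodType R;
  finc : forall i, {linear fsub i -> fmod};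
  fquo : fidx -> fidx -> mob C;
  fprj : forall i j, {linear fsub j -> mmod (fquo i j)};
  fnat : forall i j k l, mhom (fquo i j) (fquo k l) }.

(* A linear map together with, for each i', k, i, j, a set of (at most one, in
   practice) maps F(k)/F(i') -> G(j)/G(i) induced by it.  A functor defined by
   limits over the quotients acts through these; see [canon]. *)
Record fhom (X Y : filtered) := Fhom {
  hlin : {linear fmod X -> fmod Y};
  hcomp : forall (i' k : fidx X) (i j : fidx Y),
    set (mhom (fquo i' k) (fquo i j)) }.

Definition filtered_cat : modcat R := @Modcat R filtered fhom fmod hlin.

Section Induced.
Variables (X Y : filtered) (phi : {linear fmod X -> fmod Y}).

(* phi(F(i)) is contained in G(j) *)
Definition maps_into (i : fidx X) (j : fidx Y) : Prop :=
  forall x : fsub i, exists y : fsub j, phi (finc i x) = finc j y.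

(* chi : F(k)/F(i') -> G(j)/G(i) is induced by phi *)
Definition induced (i' k : fidx X) (i j : fidx Y)
    (chi : {linear mmod (fquo i' k) -> mmod (fquo i j)}) : Prop :=
  forall (x : fsub k) (y : fsub j),
    phi (finc k x) = finc j y -> chi (fprj i' k x) = fprj i j y.

End Induced.

Definition fid (X : filtered) : {linear fmod X -> fmod X} := idfun.

Record is_filtration (X : filtered) : Prop := IsFiltration {
  idx_countable : countable [set: fidx X];
  idx_lower : forall i j : fidx X, exists k, (k <= i)%O /\ (k <= j)%O;
  idx_upper : forall i j : fidx X, exists k, (i <= k)%O /\ (j <= k)%O;
  inc_inj : forall i : fidx X, injective (finc i);
  sub_mono : forall i j : fidx X, (i <= j)%O -> maps_into (fid X) i j;
  sub_cap : forall a : fmod X, (forall i, range (finc i) a) -> a = 0;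
  sub_cup : forall a : fmod X, exists i, range (finc i) a;
  prj_surj : forall i j : fidx X, (i <= j)%O -> range (fprj i j) = setT;
  prj_ker : forall i j : fidx X, (i <= j)%O ->
    forall x : fsub j, fprj i j x = 0 <-> range (finc i) (finc j x) }.

End Filtered.

Section Categories.
Variable R : comPzRingType.

Definition level0 : modcat R :=
  @Modcat R (lmodType R) (fun A B => {linear A -> B}) id (fun _ _ => id).

(* Data for A_n, the category of n-fold filtered R-modules built from the
   finite ones; its objects and morphisms are singled out by [isobj] and
   [ismor] below, and its strong subcategory S_n by [sobj] and [smor]. *)
Fixpoint level (n : nat) : modcat R :=
  if n is m.+1 then filtered_cat (level m) else level0.

Implicit Type n : nat.

(* phi : (A,F) -> (B,G) is a morphism of A_n *)
Fixpoint ismor n : forall X Y : mob (level n),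
    {linear mmod X -> mmod Y} -> Prop :=
  match n with
  | 0 => fun _ _ _ => True
  | m.+1 => fun (X Y : filtered (level m)) phi =>
    forall (i : fidx X) (j : fidx Y), exists i0 j0,
    [/\ (i0 <= i)%O, (j <= j0)%O & forall i' j', (i' <= i0)%O -> (j0 <= j')%O ->
      [/\ maps_into phi i' j, maps_into phi i j' &
        exists2 chi : {linear mmod (fquo i' i) -> mmod (fquo j j')},
          induced phi chi & ismor chi]]
  end.

(* phi with all the A_{n-1}-morphisms F(k)/F(i') -> G(j)/G(i) it induces.  No
   choice of filtrations induced one by the other is needed, since the indices
   on the two sides are independent. *)
Fixpoint canon n : forall X Y : mob (level n),
    {linear mmod X -> mmod Y} -> mhom X Y :=
  match n with
  | 0 => fun _ _ phi => phi
  | m.+1 => fun (X Y : filtered (level m)) phi =>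
    @Fhom _ _ X Y phi (fun i' k i j h =>
      [/\ (i' <= k)%O, (i <= j)%O, maps_into phi i' i, maps_into phi k j &
        exists2 chi, induced phi chi /\ ismor chi & h = canon chi])
  end.

(* X is an object of A_n *)
Fixpoint isobj n : mob (level n) -> Prop :=
  match n with
  | 0 => fun A : lmodType R => finite_set [set: A]
  | m.+1 => fun X : filtered (level m) =>
    [/\ is_filtration X,
        forall i j : fidx X, (i <= j)%O -> isobj (fquo i j) &
        forall i j k l : fidx X,
          (i <= j)%O -> (k <= l)%O -> (i <= k)%O -> (j <= l)%O ->
          exists2 chi, induced (fid X) chi /\ ismor chi &
                       fnat i j k l = canon chi]
  end.

Section Exactness.
Variable n : nat.
Implicit Types X Y Z : mob (level n).

Definition iskernel X Y Z (kappa : {linear mmod X -> mmod Y})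
    (phi : {linear mmod Y -> mmod Z}) : Prop :=
  [/\ isobj X, ismor kappa, phi \o kappa =1 \0 &
    forall T (tau : {linear mmod T -> mmod Y}), isobj T -> ismor tau ->
      phi \o tau =1 \0 ->
    exists sigma : {linear mmod T -> mmod X},
      [/\ ismor sigma, kappa \o sigma =1 tau &
        forall sigma' : {linear mmod T -> mmod X},
          ismor sigma' -> kappa \o sigma' =1 tau -> sigma' =1 sigma]].

Definition iscokernel X Y Z (lambda : {linear mmod Y -> mmod Z})
    (phi : {linear mmod X -> mmod Y}) : Prop :=
  [/\ isobj Z, ismor lambda, lambda \o phi =1 \0 &
    forall T (tau : {linear mmod Y -> mmod T}), isobj T -> ismor tau ->
      tau \o phi =1 \0 ->
    exists sigma : {linear mmod Z -> mmod T},
      [/\ ismor sigma, sigma \o lambda =1 tau &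
        forall sigma' : {linear mmod Z -> mmod T},
          ismor sigma' -> sigma' \o lambda =1 tau -> sigma' =1 sigma]].

(* 0 -> X -> Y -> Z -> 0 is exact in A_n *)
Definition exact X Y Z (alpha : {linear mmod X -> mmod Y})
    (beta : {linear mmod Y -> mmod Z}) : Prop :=
  iskernel alpha beta /\ iscokernel beta alpha.

Definition isiso X Y (phi : {linear mmod X -> mmod Y}) : Prop :=
  ismor phi /\ exists psi : {linear mmod Y -> mmod X},
    [/\ ismor psi, cancel phi psi & cancel psi phi].

(* The canonical map coker (ker phi) -> ker (coker phi) is an isomorphism. *)
Definition quasi_strong X Y (phi : {linear mmod X -> mmod Y}) : Prop :=
  ismor phi /\
  exists K (kappa : {linear mmod K -> mmod X})
         L (lambda : {linear mmod Y -> mmod L})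
         P (pi : {linear mmod X -> mmod P})
         N (nu : {linear mmod N -> mmod Y})
         (can : {linear mmod P -> mmod N}),
  [/\ iskernel kappa phi /\ iscokernel lambda phi,
      iscokernel pi kappa, iskernel nu lambda,
      phi =1 nu \o can \o pi & isiso can].

End Exactness.

Fixpoint strong n : mob (level n) -> Prop :=
  match n with
  | 0 => fun _ => True
  | m.+1 => fun X : filtered (level m) =>
    (forall i j : fidx X, (i <= j)%O -> strong (fquo i j)) /\
    (forall i j k : fidx X, (i <= j)%O -> (j <= k)%O ->
      exact (mlin (fnat i j i k)) (mlin (fnat i k j k)))
  end.

Definition sobj n (X : mob (level n)) : Prop := isobj X /\ strong X.
Definition smor n (X Y : mob (level n)) (phi : {linear mmod X -> mmod Y}) :=
  [/\ sobj X, sobj Y & quasi_strong phi].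

End Categories.

Section Extension.
Variables R K : pzRingType.

(* A family of maps u i j, seen as components that do not shift the indices. *)
Inductive diag (I : Type) (H : I -> I -> I -> I -> Type)
    (u : forall i j, H i j i j) : forall i' k i j, set (H i' k i j) :=
  Diag i j : @diag I H u i j i j (u i j).

Section Step.
Variables (C : modcat R) (o : flavour).

(* The system (F(F(j)/F(i)))_ij of a contravariant F *)
Definition cosys (F : cofunctor K C) (X : filtered C) : bisys K :=
  @Bisys K (fidx X) (fun i j => (i <= j)%O) (fun i j => cob F (fquo i j))
    (fun i j k l => cmap F (fnat i j k l)).
Definition cocomp (F : cofunctor K C) (X Y : filtered C) (h : fhom X Y) :
    components (cosys F Y) (cosys F X) :=
  fun i' k i j => [set cmap F c | c in @hcomp _ _ X Y h i' k i j].
Definition costep (F : cofunctor K C) : cofunctor K (filtered_cat C) :=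
  @Cofunctor _ _ (filtered_cat C) (fun X => ilim o (cosys F X))
    (fun X Y h => ilim_map o (@cocomp F X Y h)).

(* For a covariant G the roles of the two indices are exchanged: the
   quotient F(j)/F(i) gives the entry (j, i), over the opposite order. *)
Definition vsys (G : functor K C) (X : filtered C) : bisys K :=
  @Bisys K (fidx X) (fun j i => (i <= j)%O) (fun j i => vob G (fquo i j))
    (fun j i l k => vmap G (fnat k l i j)).
Definition vcomp (G : functor K C) (X Y : filtered C) (h : fhom X Y) :
    components (vsys G X) (vsys G Y) :=
  fun j i k i' => [set vmap G c | c in @hcomp _ _ X Y h i' k i j].
Definition vstep (G : functor K C) : functor K (filtered_cat C) :=
  @Functor _ _ (filtered_cat C) (fun X => ilim o (vsys G X))
    (fun X Y h => ilim_map o (@vcomp G X Y h)).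

End Step.
End Extension.

Fixpoint coext (R : comPzRingType) (K : pzRingType) (o : flavour)
    (F : cofunctor K (level0 R)) (n : nat) : cofunctor K (level R n) :=
  if n is m.+1 then costep o (coext o F m) else F.

Fixpoint vext (R : comPzRingType) (K : pzRingType) (o : flavour)
    (G : functor K (level0 R)) (n : nat) : functor K (level R n) :=
  if n is m.+1 then vstep o (vext o G m) else G.

Definition QmodZ : zmodType :=
  Quotient.quot (GRing.ZmodClosed.clone rat Num.int_num_subdef _).

Section Characters.
Variables (R : comPzRingType) (A : lmodType R).

(* Hom_Z(A, Q/Z), with (r alpha)(a) = alpha(r a) *)
Record character := Character {
  char_fun :> A -> QmodZ;
  charD : {morph char_fun : a b / a + b} }.

HB.instance Definition _ := gen_eqMixin character.
HB.instance Definition _ := gen_choiceMixin character.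

Lemma characterP (f g : character) : f =1 g -> f = g.
Proof.
case: f g => [f f1] [g g1] /= /funext fg.
by subst g; congr Character; exact: Prop_irrelevance.
Qed.

Program Definition char_zero := @Character (fun=> 0) _.
Next Obligation. by move=> a b; rewrite addr0. Qed.
Program Definition char_opp (f : character) := @Character (fun a => - f a) _.
Next Obligation. by move=> f a b /=; rewrite charD opprD. Qed.
Program Definition char_add (f g : character) :=
  @Character (fun a => f a + g a) _.
Next Obligation. by move=> f g a b /=; rewrite !charD addrACA. Qed.
Program Definition char_scale (r : R) (f : character) :=
  @Character (fun a => f (r *: a)) _.
Next Obligation. by move=> r f a b /=; rewrite scalerDr charD. Qed.

Fact char_addA : associative char_add.
Proof. by move=> f g h; apply: characterP => a /=; rewrite addrA. Qed.
Fact char_addC : commutative char_add.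
Proof. by move=> f g; apply: characterP => a /=; rewrite addrC. Qed.
Fact char_add0 : left_id char_zero char_add.
Proof. by move=> f; apply: characterP => a /=; rewrite add0r. Qed.
Fact char_addN : left_inverse char_zero char_opp char_add.
Proof. by move=> f; apply: characterP => a /=; rewrite addNr. Qed.
HB.instance Definition _ :=
  GRing.isZmodule.Build character char_addA char_addC char_add0 char_addN.

Fact char_scaleA r s f : char_scale r (char_scale s f) = char_scale (r * s) f.
Proof. by apply: characterP => a /=; rewrite scalerA mulrC. Qed.
Fact char_scale1 : left_id 1 char_scale.
Proof. by move=> f; apply: characterP => a /=; rewrite scale1r. Qed.
Fact char_scaleDr : right_distributive char_scale +%R.
Proof. by move=> r f g; apply: characterP. Qed.
Fact char_scaleDl f : {morph char_scale^~ f : r s / r + s}.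
Proof. by move=> r s; apply: characterP => a /=; rewrite scalerDl charD. Qed.
HB.instance Definition _ := GRing.Zmodule_isLmodule.Build R character
  char_scaleA char_scale1 char_scaleDr char_scaleDl.

End Characters.

Section Transpose.
Variables (R : comPzRingType) (A B : lmodType R) (phi : {linear A -> B}).
Program Definition transpose (f : character B) : character A :=
  @Character _ A (fun a => f (phi a)) _.
Next Obligation. by move=> f a b /=; rewrite linearD charD. Qed.
Fact transpose_linear : linear transpose.
Proof. by move=> r f g; apply: characterP => a /=; rewrite linearZ. Qed.
HB.instance Definition _ := GRing.isLinear.Build R (character B) (character A)
  *:%R transpose transpose_linear.
End Transpose.

Section Evaluation.
Variables (R : comPzRingType) (A : lmodType R).
Definition evaluation (a : A) : character (character A) :=
  @Character _ (character A) (fun alpha => alpha a) (fun _ _ => erefl).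
Fact evaluation_linear : linear evaluation.
Proof.
by move=> r a b; apply: characterP => alpha /=; rewrite charD.
Qed.
HB.instance Definition _ := GRing.isLinear.Build R A
  (character (character A)) *:%R evaluation evaluation_linear.
End Evaluation.

Record duality (R : pzRingType) (C : modcat R) := Duality {
  dob : mob C -> mob C;
  dmor : forall X Y : mob C, mhom X Y -> mhom (dob Y) (dob X) }.

Section DualStep.
Variables (R : pzRingType) (C : modcat R) (D : duality C).

Definition dual_mod : cofunctor R C :=
  @Cofunctor R R C (fun X => mmod (dob D X)) (fun X Y h => mlin (dmor D h)).

Definition dual_sub (X : filtered C) (i : fidx X) : lmodType R :=
  lim (@row_diag _ (cosys dual_mod X) i).
Definition dual_inc (X : filtered C) (i : fidx X) :
    {linear dual_sub i -> colimlim (cosys dual_mod X)} :=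
  @colim_in _ (colimlim_diag (cosys dual_mod X)) i
    : {linear @dmod _ (colimlim_diag (cosys dual_mod X)) i -> colim _}.
Definition dual_prj (X : filtered C) (i j : fidx X) :
    {linear dual_sub i -> mmod (dob D (fquo i j))} :=
  @lim_proj _ (@row_diag _ (cosys dual_mod X) i) j
    : {linear lim _ -> @dmod _ (@row_diag _ (cosys dual_mod X) i) j}.

(* The module is colim_i lim_j of the duals of the F(j)/F(i), with the
   filtration lim_j, whose quotients are the duals of the F(j)/F(i). *)
Definition dual_filtered (X : filtered C) : filtered C :=
  @Filtered R C (colimlim (cosys dual_mod X)) _ (fidx X)^d%O
    (@dual_sub X)
    (@dual_inc X)
    (fun j i => dob D (fquo i j))
    (fun j i => dual_prj i j)
    (fun j i l k => dmor D (fnat k l i j)).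

Definition dual_fhom (X Y : filtered C) (h : fhom X Y) :
    fhom (dual_filtered Y) (dual_filtered X) :=
  @Fhom R C (dual_filtered Y) (dual_filtered X)
    (colimlim_map (@cocomp _ _ _ dual_mod X Y h))
    (fun j i k i' => [set dmor D c | c in @hcomp _ _ X Y h i' k i j]).

Definition dual_step : duality (filtered_cat C) :=
  @Duality R (filtered_cat C) dual_filtered dual_fhom.

(* The natural map to the double dual, given those of the F(j)/F(i). *)
Definition delta_step
    (delta : forall Q : mob C, mhom Q (dob D (dob D Q))) (X : filtered C) :
    fhom X (dual_filtered (dual_filtered X)) :=
  let X1 := dual_filtered X in
  let X2 := dual_filtered X1 in
  @Fhom R C X X2
    (the_linear (fun u : {linear fmod X -> fmod X2} =>
       forall (j : fidx X) (x : fsub j) (g : @dual_sub X1 j),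
       (forall i : fidx X, (i <= j)%O ->
          @dual_prj X1 j i g = mlin (delta (fquo i j)) (fprj i j x)) ->
       u (finc j x) = @dual_inc X1 j g))
    (@diag (fidx X) (fun i' k i j => mhom (fquo i' k) (dob D (dob D (fquo i j))))
       (fun i j => delta (fquo i j))).

End DualStep.

Section Dual.
Variable R : comPzRingType.

Definition dual0 : duality (level0 R) :=
  @Duality R (level0 R) (fun A => character A : lmodType R)
    (fun A B phi => transpose phi : {linear _ -> _}).

Fixpoint dual (n : nat) : duality (level R n) :=
  if n is m.+1 then dual_step (dual m) else dual0.

Definition bidual n (X : mob (level R n)) : mob (level R n) :=
  dob (dual n) (dob (dual n) X).

Fixpoint delta n : forall X : mob (level R n), mhom X (bidual X) :=
  match n with
  | 0 => fun A : lmodType R => @evaluation R A : {linear _ -> _}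
  | m.+1 => fun X => @delta_step _ _ (dual m) (@delta m) X
  end.

End Dual.

Section FunctionSpaces.
Variables (R : comPzRingType) (T : realType).
Local Notation C := (T[i]).

Section FiniteModules.
Variables A B : lmodType R.

Definition pullback (phi : A -> B) (f : B -> C^o) : A -> C^o := f \o phi.
Fact pullback_linear phi : linear (pullback phi).
Proof. by []. Qed.
HB.instance Definition _ phi := GRing.isLinear.Build C (B -> C^o) (A -> C^o)
  *:%R (pullback phi) (pullback_linear phi).

(* Sums over a finite module are written as sums over [fset_set]; they are only
   meaningful when the module is finite. *)
Definition pushforward (phi : A -> B) (f : A -> C^o) : B -> C^o :=
  fun x => \sum_(y <- fset_set [set y | phi y = x]) f y.
Fact pushforward_linear phi : linear (pushforward phi).
Proof.
move=> a f g; apply/funext => x.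
rewrite /pushforward -[RHS]/(a * \sum_(y <- _) f y + \sum_(y <- _) g y).
by rewrite mulr_sumr -big_split.
Qed.
HB.instance Definition _ phi := GRing.isLinear.Build C (A -> C^o) (B -> C^o)
  *:%R (pushforward phi) (pushforward_linear phi).

End FiniteModules.

(* e^(2 pi i x); the choice of the representative of x is irrelevant *)
Definition expi (x : QmodZ) : C :=
  let t : T := 2 * pi * ratr (repr x) in (cos t +i* sin t)%C.

Section FiniteFourier.
Variable A : lmodType R.

Definition fourier0 (f : A -> C^o) : character A -> C^o := fun alpha =>
  (#|` fset_set [set: A]|%:R)^-1 *
  \sum_(a <- fset_set [set: A]) f a * expi (- alpha a).
Definition fourier0' (f : A -> C^o) : character A -> C^o := fun alpha =>
  \sum_(a <- fset_set [set: A]) f a * expi (alpha a).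

Fact sum_linear (s : seq A) (e : A -> C) (a : C) (f g : A -> C) :
  \sum_(x <- s) (a * f x + g x) * e x =
  a * \sum_(x <- s) f x * e x + \sum_(x <- s) g x * e x.
Proof.
rewrite mulr_sumr -big_split /=.
by apply: eq_bigr => b _; rewrite mulrA -mulrDl.
Qed.

Fact fourier0_linear : linear fourier0.
Proof.
move=> a f g; apply/funext => x.
transitivity ((#|` fset_set [set: A]|%:R : C)^-1 *
  \sum_(b <- fset_set [set: A])
    (a * (f b : C) + (g b : C)) * expi (- x b)) => //.
by rewrite sum_linear mulrDr mulrCA.
Qed.
HB.instance Definition _ := GRing.isLinear.Build C (A -> C^o)
  (character A -> C^o) *:%R fourier0 fourier0_linear.

Fact fourier0'_linear : linear fourier0'.
Proof. by move=> a f g; apply/funext => x; apply: sum_linear. Qed.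
HB.instance Definition _ := GRing.isLinear.Build C (A -> C^o)
  (character A -> C^o) *:%R fourier0' fourier0'_linear.

End FiniteFourier.

Definition fun_pull : cofunctor C (level0 R) :=
  @Cofunctor R C (level0 R) (fun A : lmodType R => (A -> C^o) : lmodType C)
    (fun A B (phi : {linear _ -> _}) => pullback phi : {linear _ -> _}).
Definition fun_push : functor C (level0 R) :=
  @Functor R C (level0 R) (fun A : lmodType R => (A -> C^o) : lmodType C)
    (fun A B (phi : {linear _ -> _}) => pushforward phi : {linear _ -> _}).

(* E_n, E~_n (contravariant) and E'_n, E~'_n (covariant).  In [vext] the first
   index of the system is j and the second one is i, so that [ColimLim] is
   colim_j lim_i and [LimColim] is lim_i colim_j. *)
Definition spE n := coext LimColim fun_pull n.
Definition spEt n := coext ColimLim fun_pull n.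
Definition spE' n := vext ColimLim fun_push n.
Definition spEt' n := vext LimColim fun_push n.

Section FourierStep.
Variables (L : modcat R) (D : duality L) (o : flavour).
Variables (F : cofunctor C L) (G : functor C L).

Definition fourier_step (t : forall Q : mob L, {linear cob F Q -> vob G (dob D Q)})
    (X : filtered L) :
    {linear cob (costep o F) X -> vob (vstep o G) (dual_filtered D X)} :=
  @ilim_map _ o (cosys F X) (vsys G (dual_filtered D X))
    (@diag (fidx X)
       (fun i' k i j => {linear cob F (fquo i j) -> vob G (dob D (fquo i' k))})
       (fun i j => t (fquo i j))).

Definition fourier_step' (t : forall Q : mob L, {linear vob G Q -> cob F (dob D Q)})
    (X : filtered L) :
    {linear vob (vstep o G) X -> cob (costep o F) (dual_filtered D X)} :=
  @ilim_map _ o (vsys G X) (cosys F (dual_filtered D X))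
    (@diag (fidx X)
       (fun j' l j i => {linear vob G (fquo i j) -> cob F (dob D (fquo l j'))})
       (fun j i => t (fquo i j))).

End FourierStep.

Fixpoint fourierE n : forall X : mob (level R n),
    {linear cob (spE n) X -> vob (spEt' n) (dob (dual R n) X)} :=
  match n with
  | 0 => fun A : lmodType R => @fourier0 A : {linear _ -> _}
  | m.+1 => fun X => @fourier_step _ (dual R m) LimColim (spE m) (spEt' m)
      (@fourierE m) X
  end.

Fixpoint fourierEt n : forall X : mob (level R n),
    {linear cob (spEt n) X -> vob (spE' n) (dob (dual R n) X)} :=
  match n with
  | 0 => fun A : lmodType R => @fourier0 A : {linear _ -> _}
  | m.+1 => fun X => @fourier_step _ (dual R m) ColimLim (spEt m) (spE' m)
      (@fourierEt m) X
  end.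

Fixpoint fourierE' n : forall X : mob (level R n),
    {linear vob (spE' n) X -> cob (spEt n) (dob (dual R n) X)} :=
  match n with
  | 0 => fun A : lmodType R => @fourier0' A : {linear _ -> _}
  | m.+1 => fun X => @fourier_step' _ (dual R m) ColimLim (spEt m) (spE' m)
      (@fourierE' m) X
  end.

Fixpoint fourierEt' n : forall X : mob (level R n),
    {linear vob (spEt' n) X -> cob (spE n) (dob (dual R n) X)} :=
  match n with
  | 0 => fun A : lmodType R => @fourier0' A : {linear _ -> _}
  | m.+1 => fun X => @fourier_step' _ (dual R m) LimColim (spE m) (spEt' m)
      (@fourierEt' m) X
  end.

End FunctionSpaces.

Section NaturalIsomorphisms.
Variables (R : comPzRingType) (K : pzRingType) (n : nat).

Definition co_bidual (F : cofunctor K (level R n)) : cofunctor K (level R n) :=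
  @Cofunctor R K (level R n) (fun X => cob F (bidual X))
    (fun X Y h => cmap F (dmor (dual R n) (dmor (dual R n) h))).
Definition v_bidual (G : functor K (level R n)) : functor K (level R n) :=
  @Functor R K (level R n) (fun X => vob G (bidual X))
    (fun X Y h => vmap G (dmor (dual R n) (dmor (dual R n) h))).

(* Isomorphisms of functors on S_n *)
Definition co_natiso (F G : cofunctor K (level R n))
    (eta : forall X, {linear cob F X -> cob G X}) : Prop :=
  (forall X, sobj X -> bijective (eta X)) /\
  (forall X Y (phi : {linear mmod X -> mmod Y}), smor phi -> forall f,
     eta X (cmap F (canon phi) f) = cmap G (canon phi) (eta Y f)).
Definition v_natiso (F G : functor K (level R n))
    (eta : forall X, {linear vob F X -> vob G X}) : Prop :=
  (forall X, sobj X -> bijective (eta X)) /\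
  (forall X Y (phi : {linear mmod X -> mmod Y}), smor phi -> forall f,
     eta Y (vmap F (canon phi) f) = vmap G (canon phi) (eta X f)).

(* delta^* : F(X^^) -> F(X) and delta_* : G(X) -> G(X^^) *)
Definition delta_pull (F : cofunctor K (level R n)) (X : mob (level R n)) :
    {linear cob (co_bidual F) X -> cob F X} := cmap F (delta X).
Definition delta_push (G : functor K (level R n)) (X : mob (level R n)) :
    {linear vob G X -> vob (v_bidual G) X} := vmap G (delta X).

End NaturalIsomorphisms.

(* Main.v *)
From HB Require Import structures.
From mathcomp Require Import all_boot all_order all_algebra reals.
From mathcomp Require Import boolp classical_sets functions cardinality.
From mathcomp Require Import ring_quotient generic_quotient finmap complex trigo lra ring.
Require Import Defs.

Set Implicit Arguments.
Unset Strict Implicit.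
Unset Printing Implicit Defensive.
Import Order.TTheory GRing.Theory Num.Theory.
Local Open Scope classical_set_scope.
Local Open Scope ring_scope.

(** The function spaces, the duals and the Fourier transforms of a filtered
    module are iterated limits over the system of its quotients F(j)/F(i).
    Duality turns F(j)/F(i) into a quotient of the dual filtration with the same
    two indices, in the opposite order, so the transforms and the maps induced by
    delta are all limits of diagonal families: linear maps u_ij : M_ij -> N_ij
    between two systems over the same indices.  Such families have limits as
    soon as they commute with the transition maps, and these limits compose
    ([diag_map_comp]).  Hence the identities F F' = delta_* and
    delta^* F' F = id, and the bijectivity of the transforms, pass from the
    quotients to the limit, and by induction on n they reduce to finite modules.
    There they are the inversion formula of a finite abelian group A
    ([fourier0K], [fourier0K']), which rests on the orthogonality relations; these
    use that characters separate the points of A ([char_separation]), because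
    Q/Z is divisible.

    Naturality is subtler.  The map that a morphism phi : (A, F) -> (B, G)
    induces on an iterated limit is only characterised by a condition, and it can
    be computed with only when that condition has exactly one solution.  Between
    strong objects it has: phi induces a morphism F(k)/F(i') -> G(j)/G(i)
    whenever it maps F(i') into G(i) and F(k) into G(j) ([induced_ismor]), and
    the images of these morphisms under a functor form a compatible family
    ([sysmor]), which has one and only one limit ([sysmor_determined]).
    Functoriality on the strong objects follows at every level.

    Duals are reached through the transforms themselves: a Fourier transform on
    the quotients is an isomorphism from a system that defines a function space
    of the module to one that defines a function space of its dual.  Under an isomorphism of systems, a family that
    corresponds to one with a unique limit has a unique limit too, and the two
    limits correspond ([transport]).  Read along the transforms, that
    correspondence is their naturality, also on the duals.

    What is proved by induction is [fourier_system].  The naturality of the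
    maps induced by delta follows, these being composites of two transforms or
    inverses of such composites. *)

(** * Linear maps given by their graph *)
Section LinearMaps.
Variable K : pzRingType.
Implicit Types U V : lmodType K.

Lemma linear_ext U V (f g : {linear U -> V}) : f =1 g -> f = g.
Proof.
move=> /funext; case: f g => [f [[fa] [fs]]] [g [[ga] [gs]]] /= fg.
subst g.
by rewrite (Prop_irrelevance fa ga) (Prop_irrelevance fs gs).
Qed.

Lemma linear_choice U V (Q : U -> V -> Prop) :
    (forall x, exists y, Q x y) ->
    (forall x y y', Q x y -> Q x y' -> y = y') ->
    (forall a x x' y y', Q x y -> Q x' y' -> Q (a *: x + x') (a *: y + y')) ->
  exists f : {linear U -> V}, forall x, Q x (f x).
Proof.
move=> Qt Qf Ql; pose g x := projT1 (cid (Qt x)).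
have gQ x : Q x (g x) by exact: projT2 (cid (Qt x)).
have glin : linear g by move=> a x y; apply: Qf (gQ _) (Ql _ _ _ _ _ (gQ x) (gQ y)).
pose L := GRing.isLinear.Build K U V *:%R g glin.
by exists (HB.pack g L : {linear U -> V}).
Qed.

(** Existence gives the characterising property; uniqueness is a separate matter,
    and is what allows comparison with another map. *)
Lemma the_linearP U V (P : {linear U -> V} -> Prop) :
  (exists f, P f) -> P (the_linear P).
Proof. by rewrite /the_linear; case: pselect => // h _; exact: projT2 (cid h). Qed.

Lemma inv_linear U V (f : {linear U -> V}) : bijective f ->
  exists g : {linear V -> U}, cancel f g /\ cancel g f.
Proof.
case=> g fK gK; have glin : linear g.
  by move=> a x y; apply: (can_inj fK); rewrite linearP !gK.
pose L := GRing.isLinear.Build K V U *:%R g glin.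
by exists (HB.pack g L : {linear V -> U}).
Qed.

End LinearMaps.

(** * Limits and colimits of diagrams of modules *)
Section Limits.
Variables (K : pzRingType) (G : diagram K).
Implicit Types (U V : lmodType K) (d e : didx G).

Lemma colim_linear_eq V (S T : {linear colim G -> V}) :
  (forall d x, dact d -> S (colim_in d x) = T (colim_in d x)) -> S =1 T.
Proof.
move=> ST x; have -> : x = \sum_(p <- repr (x : {eq_quot @fsum_eq K G}%qT))
    colim_in (tag p) (tagged p).
  by apply: colimP => c; rewrite linear_sum; apply: eq_bigr => p _;
     rewrite /= colim_eval_in.
rewrite !linear_sum; apply: eq_bigr => -[d y] _ /=.
by have [/ST->//|nd] := pselect (dact d); rewrite colim_in_out // !linear0.
Qed.

(** The terms of a formal sum can be moved to a common index and added there. *)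
Lemma colim_inP :
    (exists d, dact d) ->
    (forall d e, dact d -> dact e -> exists f, dedge d f /\ dedge e f) ->
  forall x : colim G, exists d y, dact d /\ x = colim_in d y.
Proof.
move=> [d0 ad0] dir x; have -> : x = \sum_(p <- repr (x : {eq_quot @fsum_eq K G}%qT))
    colim_in (tag p) (tagged p).
  by apply: colimP => c; rewrite linear_sum; apply: eq_bigr => p _;
     rewrite /= colim_eval_in.
elim: (repr _) => [|[d y] s [e [z [ae E]]]].
  by exists d0, 0; rewrite big_nil linear0.
rewrite big_cons E /=; have [ad|nd] := pselect (dact d); last first.
  by exists e, z; rewrite colim_in_out // add0r.
have [f [df ef]] := dir _ _ ad ae.
exists f, (dmap d f y + dmap e f z); split; first by case: df.
by rewrite linearD /= !colim_in_map.
Qed.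

(** [Q d] is the graph of the leg at [d].  It may be given through auxiliary
    choices, as long as its value does not depend on them. *)
Lemma colim_exists V (Q : forall d, dmod d -> V -> Prop) :
    (forall d, dact d -> forall x, exists y, Q d x y) ->
    (forall d, dact d -> forall x y y', Q d x y -> Q d x y' -> y = y') ->
    (forall d, dact d -> forall a x x' y y', Q d x y -> Q d x' y' ->
       Q d (a *: x + x') (a *: y + y')) ->
    (forall d e, dedge d e -> forall x y y', Q d x y -> Q e (dmap d e x) y' ->
       y = y') ->
  exists T : {linear colim G -> V},
    forall d x y, dact d -> Q d x y -> T (colim_in d x) = y.
Proof.
move=> Qt Qf Ql Qc.
have ex d : exists f : {linear dmod d -> V},
    (dact d -> forall x, Q d x (f x)) /\ (~ dact d -> forall x, f x = 0).
  have [ad|nd] := pselect (dact d).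
    by have [f fQ] := linear_choice (Qt d ad) (Qf d ad) (Ql d ad); exists f.
  by exists \0.
pose f d := projT1 (cid (ex d)).
have fP d : (dact d -> forall x, Q d x (f d x)) /\ (~ dact d -> forall x, f d x = 0).
  exact: projT2 (cid (ex d)).
have f_map d e : dedge d e -> forall x, f e (dmap d e x) = f d x.
  move=> de x; have [ad ae _] := de; apply/esym/(Qc _ _ de x).
    exact: (fP d).1.
  exact: (fP e).1.
pose c := Cocone f_map (fun d nd x => (fP d).2 nd x).
exists (@colim_eval K G c : {linear colim G -> apex c}) => d x y ad Qxy.
by rewrite [LHS](colim_eval_in c); apply: Qf Qxy => //; apply: (fP d).1.
Qed.

Lemma lim_ext (f g : lim G) : (forall d, dact d -> f d = g d) -> f = g.
Proof.
move=> fg; apply: limP => d; have [/fg//|nd] := pselect (dact d).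
by rewrite !lim_out.
Qed.

Lemma lim_make (Q : forall d, dmod d -> Prop) :
    (forall d, dact d -> exists y, Q d y) ->
    (forall d, dact d -> forall y y', Q d y -> Q d y' -> y = y') ->
    (forall d e, dedge d e -> forall y, Q d y -> Q e (dmap d e y)) ->
  exists f : lim G, forall d, dact d -> Q d (f d).
Proof.
move=> Qt Qf Qc.
have ex d : exists y : dmod d, (dact d -> Q d y) /\ (~ dact d -> y = 0).
  have [ad|nd] := pselect (dact d); last by exists 0.
  by have [y Qy] := Qt d ad; exists y.
pose f d := projT1 (cid (ex d)).
have fP d : (dact d -> Q d (f d)) /\ (~ dact d -> f d = 0).
  exact: projT2 (cid (ex d)).
have f_map d e : dedge d e -> dmap d e (f d) = f e.
  move=> de; have [ad ae _] := de; apply: (Qf _ ae); last exact: (fP e).1.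
  by apply: Qc => //; exact: (fP d).1.
by exists (Lim f_map (fun d nd => (fP d).2 nd)) => d ad; exact: (fP d).1.
Qed.

Lemma lim_exists U (Q : forall d, U -> dmod d -> Prop) :
    (forall d, dact d -> forall x, exists y, Q d x y) ->
    (forall d, dact d -> forall x y y', Q d x y -> Q d x y' -> y = y') ->
    (forall d, dact d -> forall a x x' y y', Q d x y -> Q d x' y' ->
       Q d (a *: x + x') (a *: y + y')) ->
    (forall d e, dedge d e -> forall x y, Q d x y -> Q e x (dmap d e y)) ->
  exists T : {linear U -> lim G}, forall d x, dact d -> Q d x (T x d).
Proof.
move=> Qt Qf Ql Qc.
have [|||T TP] := @linear_choice K U (lim G) (fun x f => forall d, dact d -> Q d x (f d)).
- move=> x; apply: (@lim_make (fun d => Q d x)) => [d ad|d ad y y'|d e de y]; first exact: Qt.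
    exact: Qf.
  exact: Qc.
- by move=> x f g fQ gQ; apply: lim_ext => d ad; exact: Qf (fQ d ad) (gQ d ad).
- by move=> a x x' f f' fQ fQ' d ad; apply: Ql; [exact: ad|exact: fQ|exact: fQ'].
by exists T => d x ad; exact: TP.
Qed.

End Limits.


(** * Directed systems with two indices *)

(** Closes goals on indices by reflexivity and transitivity, when these are in
    the context. *)
Ltac ord := solve [eauto 6].

Record bilaw (K : pzRingType) (M : bisys K) : Prop := Bilaw {
  ble_refl : forall i : bidx M, ble i i;
  ble_trans : forall j i k : bidx M, ble i j -> ble j k -> ble i k;
  ble_lower : forall i j : bidx M, exists k, ble k i /\ ble k j;
  ble_upper : forall i j : bidx M, exists k, ble i k /\ ble j k;
  bmap_id : forall i j : bidx M, ble i j -> forall x, bmap i j i j x = x;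
  bmap_comp : forall i j k l m n : bidx M, ble i j -> ble k l -> ble m n ->
    ble i k -> ble k m -> ble j l -> ble l n ->
    forall x, bmap i j k l (bmap k l m n x) = bmap i j m n x }.

Section Transitions.
Variables (K : pzRingType) (M : bisys K).
Hypothesis lawM : bilaw M.
Implicit Types i j k l : bidx M.

Lemma col_in_map i k j (x : bmod k j) : ble i k -> ble k j ->
  @colim_in _ (col_diag j) i (bmap i j k j x) = @colim_in _ (col_diag j) k x.
Proof.
move=> ik kj; apply: (@colim_in_map _ (col_diag j) k i x).
by split=> //; apply: ble_trans kj.
Qed.

(** An index [i <= k] can be lowered until it is below [j], the indices being
    directed, and the image does not depend on how far it is lowered. *)
Lemma col_mapE j k i (x : bmod i k) : ble j k -> ble i j ->
  col_map k j (@colim_in _ (col_diag k) i x) =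
  @colim_in _ (col_diag j) i (bmap i j i k x).
Proof.
move=> jk ij; apply: (the_linearP (P := fun T : {linear _ -> _} => forall i x, ble i j ->
  T (@colim_in _ (col_diag k) i x) = @colim_in _ (col_diag j) i (bmap i j i k x))) => //.
have tr := @ble_trans _ _ lawM; have rf := ble_refl lawM.
have [||||T TP] := @colim_exists K (col_diag k) (colim (col_diag j))
  (fun i x y => forall i', ble i' i -> ble i' j ->
     y = @colim_in _ (col_diag j) i' (bmap i' j i k x)).
- move=> /= d dk y; have [e [ed ej]] := ble_lower lawM d j.
  exists (@colim_in _ (col_diag j) e (bmap e j d k y)) => f fd fj.
  have [g [ge gf]] := ble_lower lawM e f.
  rewrite -(@col_in_map g) // -[RHS](@col_in_map g) //.
  by rewrite !(bmap_comp lawM) //; ord.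
- move=> /= d dk y z z' zP z'P; have [e [ed ej]] := ble_lower lawM d j.
  by rewrite (zP e) // (z'P e).
- move=> /= d dk a y y' z z' zP z'P e ed ej.
  by rewrite (zP e) // (z'P e) // !linearP.
- move=> /= d e [/= dk ek ed] y z z' zP z'P; have [f [fe fj]] := ble_lower lawM e j.
  rewrite (zP f) ?(z'P f) //; last exact: tr ed.
  by rewrite (bmap_comp lawM) //; ord.
exists T => d y dj; apply: TP => /=; first exact: tr jk.
move=> e ed ej; rewrite -[LHS](@col_in_map e) //.
by rewrite (bmap_comp lawM) //; ord.
Qed.

(** A component [j >= i] of the image is read off from any index above both [j]
    and [k]. *)
Lemma row_mapE i k j (f : lim (row_diag k)) : ble i k -> ble k j ->
  (row_map k i f : lim (row_diag i)) j = bmap i j k j (f j).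
Proof.
move=> ik kj.
apply: (the_linearP (P := fun T : {linear lim (row_diag k) -> lim (row_diag i)} =>
    forall (f : lim (row_diag k)) j, ble k j -> (T f) j = bmap i j k j (f j))) => //.
have tr := @ble_trans _ _ lawM; have rf := ble_refl lawM.
have [||||T TP] := @lim_exists K (row_diag i) (lim (row_diag k))
  (fun j f y => forall l, ble k l -> ble j l -> y = bmap i j k l (f l)).
- move=> /= d id g; have [e [ke de]] := ble_upper lawM k d.
  exists (bmap i d k e (g e)) => l kl dl; have [m [em lm]] := ble_upper lawM e l.
  have ge : g e = bmap k e k m (g m).
    by rewrite -(@lim_map _ _ g m e) //; split=> //=; ord.
  have gl : g l = bmap k l k m (g m).
    by rewrite -(@lim_map _ _ g m l) //; split=> //=; ord.
  by rewrite ge gl !(bmap_comp lawM) //; ord.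
- move=> /= d id g y y' yP y'P; have [e [ke de]] := ble_upper lawM k d.
  by rewrite (yP e) // (y'P e).
- move=> /= d id a g g' y y' yP y'P e ke de.
  by rewrite (yP e) // (y'P e) // linearP.
- move=> /= d e [/= id ie ed] g y yP l kl el; have [m [lm dm]] := ble_upper lawM l d.
  have km : ble k m by exact: tr lm.
  have gl : g l = bmap k l k m (g m) by rewrite -(@lim_map _ _ g m l).
  by rewrite (yP m) // gl !(bmap_comp lawM) //; ord.
by exists T => g d kd; apply: TP => //=; ord.
Qed.

End Transitions.

(** * Limits of families of components *)
Section Specification.
Variables (K : pzRingType) (N M : bisys K).
Implicit Type c : components N M.

Definition lc_spec c (S : {linear limcolim N -> limcolim M}) : Prop :=
  forall (f : lim (limcolim_diag N)) i' k i j u (x : bmod i j),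
    ble i' k -> ble i j -> c i' k i j u ->
    f j = @colim_in _ (col_diag j) i x ->
    (S f : lim (limcolim_diag M)) k = @colim_in _ (col_diag k) i' (u x).

Definition cl_spec c (S : {linear colimlim N -> colimlim M}) : Prop :=
  forall i (f : lim (row_diag i)) i' (g : lim (row_diag i')),
    (forall k, ble i' k ->
       exists j, ble i j /\ exists2 u, c i' k i j u & g k = u (f j)) ->
    S (@colim_in _ (colimlim_diag N) i f) = @colim_in _ (colimlim_diag M) i' g.

Definition ispec (o : flavour) c : {linear ilim o N -> ilim o M} -> Prop :=
  match o with LimColim => lc_spec c | ColimLim => cl_spec c end.

(** [ilim_map] picks some solution of the specification, so it can be compared
    with another solution only when there is just one. *)
Definition determined (o : flavour) c : Prop :=
  (exists S, ispec (o := o) c S) /\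
  forall S S', ispec (o := o) c S -> ispec (o := o) c S' -> S =1 S'.

Lemma ilim_map_spec o c : (exists S, ispec (o := o) c S) ->
  ispec c (ilim_map o c).
Proof. by case: o => h; exact: the_linearP. Qed.

(** A larger family imposes more conditions on its limit. *)
Lemma ispec_sub o c c' S :
  (forall i' k i j, ble i' k -> ble i j -> c i' k i j `<=` c' i' k i j) ->
  ispec (o := o) c' S -> ispec c S.
Proof.
case: o S => S cc' sp /=.
  by move=> f i' k i j u x i'k ij /(cc' _ _ _ _ i'k ij); exact: sp.
move=> i f i' g h; apply: sp => k i'k; have [j [ij [u cu gk]]] := h k i'k.
by exists j; split=> //; exists u => //; exact: cc'.
Qed.

End Specification.

Section Representatives.
Variables (K : pzRingType) (M : bisys K).
Hypothesis lawM : bilaw M.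

Lemma col_rep (k j : bidx M) (x : colim (col_diag k)) :
  exists i (y : bmod i k), [/\ ble i j, ble i k & x = @colim_in _ (col_diag k) i y].
Proof.
have tr := @ble_trans _ _ lawM; have rf := ble_refl lawM.
have [||i [y [ik ->]]] := @colim_inP _ (col_diag k) _ _ x.
- by exists k; exact: rf.
- move=> /= d e dk ek; have [f [fd fe]] := ble_lower lawM d e.
  by exists f; split; split=> //=; ord.
have [i' [i'i i'j]] := ble_lower lawM i j.
exists i', (bmap i' k i k y); split=> //; first exact: tr ik.
by rewrite col_in_map.
Qed.

Lemma row_lim_map (i j k : bidx M) (f : lim (row_diag i)) : ble i j -> ble j k ->
  bmap i j i k (f k) = f j.
Proof.
move=> ij jk; apply: (@lim_map _ (row_diag i) f k j); split=> //.
exact: (ble_trans lawM) ij jk.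
Qed.

Lemma row_lim_ext (i k : bidx M) (f g : lim (row_diag i)) :
  (forall l, ble i l -> ble k l -> f l = g l) -> f = g.
Proof.
move=> fg; apply: lim_ext => l /= il; have [m [lm km]] := ble_upper lawM l k.
have im := ble_trans lawM il lm.
by rewrite -(row_lim_map f il lm) -(row_lim_map g il lm) fg.
Qed.

Lemma limcolim_transition (j k : bidx M) (f : lim (limcolim_diag M)) : ble j k ->
  col_map k j (f k) = f j.
Proof. by move=> jk; apply: (@lim_map _ (limcolim_diag M) f k j). Qed.

Lemma colimlim_in_map (i k : bidx M) (f : lim (row_diag k)) : ble i k ->
  @colim_in _ (colimlim_diag M) i (row_map k i f) =
  @colim_in _ (colimlim_diag M) k f.
Proof. by move=> ik; apply: (@colim_in_map _ (colimlim_diag M) k i). Qed.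

End Representatives.

(** The families induced by a morphism phi from (A, F) to (B, G).  For a
    contravariant functor, where N belongs to B and M to A, [A i' i] stands for
    phi(F(i')) contained in G(i) and [B k j] for phi(F(k)) contained in G(j).
    For a covariant one, where N belongs to A and M to B, both orders are
    reversed, [A j k] stands for phi(F(k)) contained in G(j) and [B i i'] for
    phi(F(i')) contained in G(i).  Because these relations are closed, any two
    components can be compared through a third one. *)
Record sysmor (K : pzRingType) (N M : bisys K)
    (A : bidx M -> bidx N -> Prop) (B : bidx M -> bidx N -> Prop)
    (c : components N M) : Prop := Sysmor {
  sysmorA : forall i, exists i', A i' i;
  sysmorB : forall k, exists j, B k j;
  sysmorAl : forall i' i i2', A i' i -> ble i2' i' -> A i2' i;
  sysmorAr : forall i' i i2, A i' i -> ble i i2 -> A i' i2;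
  sysmorBl : forall k j k2, B k j -> ble k2 k -> B k2 j;
  sysmorBr : forall k j j2, B k j -> ble j j2 -> B k j2;
  sysmor_ex : forall i' k i j, ble i' k -> ble i j -> A i' i -> B k j ->
    exists u, c i' k i j u;
  sysmor_sub : forall i' k i j u, ble i' k -> ble i j -> c i' k i j u ->
    A i' i /\ B k j;
  sysmor_compat : forall i' k i j u i2' k2 i2 j2 u2,
    ble i' k -> ble i j -> ble i2' k2 -> ble i2 j2 ->
    c i' k i j u -> c i2' k2 i2 j2 u2 ->
    ble i2' i' -> ble k2 k -> ble i2 i -> ble j2 j ->
    forall x, u2 (bmap i2 j2 i j x) = bmap i2' k2 i' k (u x) }.

Section Sysmor.
Variables (K : pzRingType) (N M : bisys K).
Variables (A B : bidx M -> bidx N -> Prop) (c : components N M).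
Arguments c : clear implicits.
Hypotheses (lawN : bilaw N) (lawM : bilaw M) (gc : sysmor A B c).

Let trN := @ble_trans _ _ lawN.
Let rfN := @ble_refl _ _ lawN.
Let trM := @ble_trans _ _ lawM.
Let rfM := @ble_refl _ _ lawM.

Lemma sysmorA_le i k : exists i', A i' i /\ ble i' k.
Proof.
have [i0 Ai0] := sysmorA gc i; have [i' [i'i0 i'k]] := ble_lower lawM i0 k.
by exists i'; split=> //; exact: (sysmorAl gc) Ai0 i'i0.
Qed.

Lemma sysmorB_le k i : exists j, B k j /\ ble i j.
Proof.
have [j0 Bj0] := sysmorB gc k; have [j [j0j ij]] := ble_upper lawN j0 i.
by exists j; split=> //; exact: (sysmorBr gc) Bj0 j0j.
Qed.

Lemma sysmor_row i' k i j u i2' u2 x : ble i' k -> ble i j -> ble i2' i' ->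
  c i' k i j u -> c i2' k i j u2 -> bmap i2' k i' k (u x) = u2 x.
Proof.
move=> i'k ij i2i cu cu2; have i2k := trM i2i i'k.
by rewrite -(sysmor_compat gc i'k ij i2k ij cu cu2) // (bmap_id lawN).
Qed.

Lemma sysmor_col i' k i j u j2 u2 x : ble i' k -> ble i j2 -> ble j2 j ->
  c i' k i j u -> c i' k i j2 u2 -> u2 (bmap i j2 i j x) = u x.
Proof.
move=> i'k ij2 j2j cu cu2; have ij := trN ij2 j2j.
by rewrite (sysmor_compat gc i'k ij i'k ij2 cu cu2) // (bmap_id lawM).
Qed.

Lemma sysmor_in i' i2' k i j u u2 x : ble i' k -> ble i2' k -> ble i j ->
  c i' k i j u -> c i2' k i j u2 ->
  @colim_in _ (@col_diag _ M k) i' (u x) = @colim_in _ (@col_diag _ M k) i2' (u2 x).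
Proof.
move=> i'k i2k ij cu cu2; have [i3' [i3i i3i2]] := ble_lower lawM i' i2'.
have [Ai' Bkj] := sysmor_sub gc i'k ij cu.
have [u3 cu3] := sysmor_ex gc (trM i3i i'k) ij (sysmorAl gc Ai' i3i) Bkj.
rewrite -(col_in_map lawM _ i3i) // (sysmor_row _ i'k ij i3i cu cu3).
by rewrite -(sysmor_row _ i2k ij i3i2 cu2 cu3) (col_in_map lawM _ i3i2).
Qed.

(** What the limit does at [k], computed at [j]; all [j] with [B k j] give the
    same result ([col_spec_indep]). *)
Definition col_spec k j (S : {linear colim (@col_diag _ N j) -> colim (@col_diag _ M k)}) :=
  forall i x i' u, ble i j -> ble i' k -> c i' k i j u ->
    S (@colim_in _ (col_diag j) i x) = @colim_in _ (col_diag k) i' (u x).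

Lemma col_spec_exists k j : B k j -> exists S, col_spec (k := k) (j := j) S.
Proof.
move=> Bkj.
have [||||S SP] := @colim_exists K (@col_diag _ N j) (colim (@col_diag _ M k))
  (fun i x y => forall i' u, ble i' k -> c i' k i j u ->
     y = @colim_in _ (col_diag k) i' (u x)).
- move=> /= i ij x; have [i' [Ai' i'k]] := sysmorA_le i k.
  have [u cu] := sysmor_ex gc i'k ij Ai' Bkj.
  by exists (@colim_in _ (col_diag k) i' (u x)) => i2' u2 i2k cu2; exact: sysmor_in.
- move=> /= i ij x y y' yP y'P; have [i' [Ai' i'k]] := sysmorA_le i k.
  have [u cu] := sysmor_ex gc i'k ij Ai' Bkj.
  by rewrite (yP _ _ i'k cu) (y'P _ _ i'k cu).
- move=> /= i ij a x x' y y' yP y'P i' u i'k cu.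
  by rewrite (yP _ _ i'k cu) (y'P _ _ i'k cu) !linearP.
- move=> /= i i2 [/= ij i2j i2i] x y y' yP y'P.
  have [i' [Ai2 i'k]] := sysmorA_le i2 k.
  have [u2 cu2] := sysmor_ex gc i'k i2j Ai2 Bkj.
  have [u cu] := sysmor_ex gc i'k ij (sysmorAr gc Ai2 i2i) Bkj.
  rewrite (yP _ _ i'k cu) (y'P _ _ i'k cu2).
  by rewrite (sysmor_compat gc i'k ij i'k i2j cu cu2) // (bmap_id lawM).
by exists S => i x i' u ij i'k cu; apply: SP => // i2' u2 i2k cu2; exact: sysmor_in.
Qed.

Lemma col_spec_le k j j2 S S2 (f : lim (limcolim_diag N)) :
  B k j -> ble j j2 -> col_spec (k := k) (j := j) S ->
  col_spec (k := k) (j := j2) S2 -> S (f j) = S2 (f j2).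
Proof.
move=> Bkj jj2 SP S2P; have [i [x [ij ij2 fj2]]] := col_rep lawN j (f j2).
have [i' [Ai' i'k]] := sysmorA_le i k.
have [u cu] := sysmor_ex gc i'k ij Ai' Bkj.
have [u2 cu2] := sysmor_ex gc i'k ij2 Ai' (sysmorBr gc Bkj jj2).
rewrite -(limcolim_transition f jj2) fj2 (col_mapE lawN) //.
by rewrite (SP _ _ _ _ ij i'k cu) (S2P _ _ _ _ ij2 i'k cu2) (sysmor_col _ i'k ij jj2 cu2 cu).
Qed.

Lemma col_spec_indep k j j2 S S2 (f : lim (limcolim_diag N)) :
  B k j -> B k j2 -> col_spec (k := k) (j := j) S ->
  col_spec (k := k) (j := j2) S2 -> S (f j) = S2 (f j2).
Proof.
move=> Bkj Bkj2 SP S2P; have [j3 [jj3 j2j3]] := ble_upper lawN j j2.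
have [S3 S3P] := col_spec_exists (sysmorBr gc Bkj jj3).
by rewrite (col_spec_le f Bkj jj3 SP S3P) (col_spec_le f Bkj2 j2j3 S2P S3P).
Qed.

Lemma sysmor_lc_exists : exists S, lc_spec c S.
Proof.
have ex k : exists p : {j : bidx N & {linear colim (@col_diag _ N j) ->
    colim (@col_diag _ M k)}}, B k (tag p) /\ col_spec (tagged p).
  have [j Bkj] := sysmorB gc k; have [S SP] := col_spec_exists Bkj.
  by exists (existT _ j S).
pose J k := tag (projT1 (cid (ex k))).
pose S k : {linear colim (@col_diag _ N (J k)) -> colim (@col_diag _ M k)} :=
  tagged (projT1 (cid (ex k))).
have BJ k : B k (J k) by exact: (projT2 (cid (ex k))).1.
have SP k : col_spec (S k) by exact: (projT2 (cid (ex k))).2.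
have [||||T TP] := @lim_exists K (limcolim_diag M) (limcolim N)
  (fun k (f : lim (limcolim_diag N)) y => y = S k (f (J k))).
- by move=> k _ f; exists (S k (f (J k))).
- by move=> k _ f y y' -> ->.
- by move=> k _ a f f' y y' -> -> /=; rewrite -linearP.
- move=> k k2 [_ _ /= k2k] f y -> {y}.
  have [j [kj k2j]] := ble_upper lawN (J k) (J k2).
  have Bkj := sysmorBr gc (BJ k) kj; have Bk2j := sysmorBr gc (BJ k2) k2j.
  have [S1 S1P] := col_spec_exists Bkj; have [S2 S2P] := col_spec_exists Bk2j.
  rewrite (col_spec_le f (BJ k) kj (SP k) S1P) (col_spec_le f (BJ k2) k2j (SP k2) S2P).
  have [i [x [ij _ ->]]] := col_rep lawN j (f j).
  have [i' [Ai' i'k2]] := sysmorA_le i k2; have i'k := trM i'k2 k2k.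
  have [u cu] := sysmor_ex gc i'k ij Ai' Bkj.
  have [u2 cu2] := sysmor_ex gc i'k2 ij Ai' Bk2j.
  rewrite (S1P _ _ _ _ ij i'k cu) (S2P _ _ _ _ ij i'k2 cu2) (col_mapE lawM) //.
  by rewrite -(sysmor_compat gc i'k ij i'k2 ij cu cu2) // (bmap_id lawN).
exists T => f i' k i j u x i'k ij cu fj; rewrite TP //.
have [_ Bkj] := sysmor_sub gc i'k ij cu; have [S1 S1P] := col_spec_exists Bkj.
by rewrite (col_spec_indep f (BJ k) Bkj (SP k) S1P) fj (S1P _ _ _ _ ij i'k cu).
Qed.

Lemma sysmor_lc_unique S S' : lc_spec c S -> lc_spec c S' -> S =1 S'.
Proof.
move=> SP S'P f; apply: lim_ext => k _; have [j Bkj] := sysmorB gc k.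
have [i [x [ij _ fj]]] := col_rep lawN j ((f : lim (limcolim_diag N)) j).
have [i' [Ai' i'k]] := sysmorA_le i k; have [u cu] := sysmor_ex gc i'k ij Ai' Bkj.
by rewrite (SP f _ _ _ _ _ _ i'k ij cu fj) (S'P f _ _ _ _ _ _ i'k ij cu fj).
Qed.

(** A compatible family over the row of [i] is carried to one over the row of
    [i'], provided that [A i' i] holds; such [i'] are arbitrarily small, and
    their choice is immaterial in the colimit ([row_image_in]). *)
Definition row_image i' i (f : lim (@row_diag _ N i)) (g : lim (@row_diag _ M i')) :=
  forall k j u, ble i' k -> ble i j -> c i' k i j u -> g k = u (f j).

Lemma row_image_exists i' i (f : lim (@row_diag _ N i)) : A i' i ->
  exists g : lim (@row_diag _ M i'), row_image f g.
Proof.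
move=> Ai.
have [|||g gP] := @lim_make K (@row_diag _ M i')
    (fun k y => forall j u, ble i j -> c i' k i j u -> y = u (f j)).
- move=> /= k i'k; have [j [Bkj ij]] := sysmorB_le k i.
  have [u cu] := sysmor_ex gc i'k ij Ai Bkj.
  exists (u (f j)) => j2 u2 ij2 cu2; have [j3 [jj3 j2j3]] := ble_upper lawN j j2.
  have [u3 cu3] := sysmor_ex gc i'k (trN ij jj3) Ai (sysmorBr gc Bkj jj3).
  rewrite -(row_lim_map lawN f ij jj3) -(row_lim_map lawN f ij2 j2j3).
  by rewrite (sysmor_col _ i'k ij jj3 cu3 cu) (sysmor_col _ i'k ij2 j2j3 cu3 cu2).
- move=> /= k i'k y y' yP y'P; have [j [Bkj ij]] := sysmorB_le k i.
  have [u cu] := sysmor_ex gc i'k ij Ai Bkj.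
  by rewrite (yP _ _ ij cu) (y'P _ _ ij cu).
- move=> /= k k2 [/= i'k i'k2 k2k] y yP j u ij cu.
  have [j3 [Bkj3 jj3]] := sysmorB_le k j; have ij3 := trN ij jj3.
  have [u3 cu3] := sysmor_ex gc i'k ij3 Ai Bkj3.
  rewrite (yP _ _ ij3 cu3) -(row_lim_map lawN f ij jj3).
  by rewrite (sysmor_compat gc i'k ij3 i'k2 ij cu3 cu).
by exists g => k j u i'k ij cu; exact: gP.
Qed.

Lemma row_image_le i' i2' i (f : lim (@row_diag _ N i)) g g2 :
  A i' i -> ble i2' i' -> row_image f g -> row_image (i' := i2') f g2 ->
  row_map i' i2' g = g2.
Proof.
move=> Ai i2i gP g2P; apply: (row_lim_ext lawM (k := i')) => k i2k i'k.
rewrite (row_mapE lawM) //; have [j [Bkj ij]] := sysmorB_le k i.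
have [u cu] := sysmor_ex gc i'k ij Ai Bkj.
have [u2 cu2] := sysmor_ex gc i2k ij (sysmorAl gc Ai i2i) Bkj.
by rewrite (gP _ _ _ i'k ij cu) (g2P _ _ _ i2k ij cu2) (sysmor_row _ i'k ij i2i cu cu2).
Qed.

Lemma row_image_in i' i2' i (f : lim (@row_diag _ N i)) g g2 :
  A i' i -> A i2' i -> row_image f g -> row_image (i' := i2') f g2 ->
  @colim_in _ (colimlim_diag M) i' g = @colim_in _ (colimlim_diag M) i2' g2.
Proof.
move=> Ai Ai2 gP g2P; have [i3' [i3i i3i2]] := ble_lower lawM i' i2'.
have [g3 g3P] := row_image_exists f (sysmorAl gc Ai i3i).
rewrite -(colimlim_in_map g i3i) -(colimlim_in_map g2 i3i2).
by rewrite (row_image_le Ai i3i gP g3P) (row_image_le Ai2 i3i2 g2P g3P).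
Qed.

Lemma sysmor_cl_exists : exists S, cl_spec c S.
Proof.
have [||||S SP] := @colim_exists K (colimlim_diag N) (colimlim M)
  (fun i (f : lim (row_diag i)) z => forall i' g, A i' i -> row_image (i' := i') f g ->
     z = @colim_in _ (colimlim_diag M) i' g).
- move=> /= i _ f; have [i' Ai] := sysmorA gc i.
  have [g gP] := row_image_exists f Ai.
  by exists (@colim_in _ (colimlim_diag M) i' g) => i2' g2 Ai2 g2P; exact: row_image_in gP g2P.
- move=> /= i _ f z z' zP z'P; have [i' Ai] := sysmorA gc i.
  have [g gP] := row_image_exists f Ai.
  by rewrite (zP _ _ Ai gP) (z'P _ _ Ai gP).
- move=> /= i _ a f f' z z' zP z'P i' g Ai gP.
  have [h hP] := row_image_exists f Ai; have [h' h'P] := row_image_exists f' Ai.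
  rewrite (zP _ _ Ai hP) (z'P _ _ Ai h'P) -linearP; congr colim_in.
  apply: lim_ext => k /= i'k; have [j [Bkj ij]] := sysmorB_le k i.
  have [u cu] := sysmor_ex gc i'k ij Ai Bkj.
  by rewrite (gP _ _ _ i'k ij cu) (hP _ _ _ i'k ij cu) (h'P _ _ _ i'k ij cu) -linearP.
- move=> /= i i2 [_ _ /= i2i] f z z' zP z'P.
  have [i' Ai2] := sysmorA gc i2; have Ai := sysmorAr gc Ai2 i2i.
  have [g gP] := row_image_exists f Ai.
  rewrite (zP _ _ Ai gP) (z'P _ g Ai2) // => k j u i'k i2j cu.
  have [l [jl il]] := ble_upper lawN j i; have i2l := trN i2j jl.
  rewrite -(row_lim_map lawN _ i2j jl) (row_mapE lawN) // (bmap_comp lawN) //.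
  have [_ Bkj] := sysmor_sub gc i'k i2j cu.
  have [u1 cu1] := sysmor_ex gc i'k il Ai (sysmorBr gc Bkj jl).
  rewrite (gP _ _ _ i'k il cu1) (sysmor_compat gc i'k il i'k i2j cu1 cu) //.
  by rewrite (bmap_id lawM).
exists S => i f i' g gf; have [j [ij [u cu _]]] := gf i' (rfM i').
have [Ai _] := sysmor_sub gc (rfM i') ij cu.
have [h hP] := row_image_exists f Ai.
have -> : g = h.
  apply: lim_ext => k /= i'k; have [j1 [ij1 [u1 cu1 ->]]] := gf k i'k.
  by rewrite (hP _ _ _ i'k ij1 cu1).
by apply: SP => // i2' g2 Ai2 g2P; exact: row_image_in hP g2P.
Qed.

Lemma row_imageP i' i (f : lim (@row_diag _ N i)) (g : lim (@row_diag _ M i')) :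
  A i' i -> row_image f g -> forall k, ble i' k ->
    exists j, ble i j /\ exists2 u, c i' k i j u & g k = u (f j).
Proof.
move=> Ai gP k i'k; have [j [Bkj ij]] := sysmorB_le k i.
have [u cu] := sysmor_ex gc i'k ij Ai Bkj.
by exists j; split=> //; exists u => //; exact: gP.
Qed.

Lemma sysmor_cl_unique S S' : cl_spec c S -> cl_spec c S' -> S =1 S'.
Proof.
move=> SP S'P; apply: colim_linear_eq => i f _ /=; have [i' Ai] := sysmorA gc i.
have [g gP] := row_image_exists f Ai; have gf := row_imageP Ai gP.
by rewrite (SP _ _ _ _ gf) (S'P _ _ _ _ gf).
Qed.

Lemma sysmor_determined o : determined o c.
Proof.
case: o; split.
- exact: sysmor_lc_exists.
- exact: sysmor_lc_unique.
- exact: sysmor_cl_exists.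
- exact: sysmor_cl_unique.
Qed.

End Sysmor.

(** * Functoriality of the limits *)
Section SysmorComposition.
Variables (K : pzRingType) (N M L : bisys K).
Variables (A B : bidx M -> bidx N -> Prop) (c : components N M).
Variables (A' B' : bidx L -> bidx M -> Prop) (c' : components M L).
Variables (A'' B'' : bidx L -> bidx N -> Prop) (c'' : components N L).
Hypotheses (lawN : bilaw N) (lawM : bilaw M) (lawL : bilaw L).
Hypotheses (gc : sysmor A B c) (gc' : sysmor A' B' c') (gc'' : sysmor A'' B'' c'').
Arguments c : clear implicits.
Arguments c' : clear implicits.
Arguments c'' : clear implicits.
Hypothesis compc : forall l' l i' k i j u v, ble i j -> ble i' k -> ble l' l ->
  c i' k i j u -> c' l' l i' k v -> exists2 w, c'' l' l i j w & w =1 v \o u.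

Lemma sysmor_comp o x : ilim_map o c'' x = ilim_map o c' (ilim_map o c x).
Proof.
have := ilim_map_spec (sysmor_determined lawN lawM gc o).1.
have := ilim_map_spec (sysmor_determined lawM lawL gc' o).1.
have := ilim_map_spec (sysmor_determined lawN lawL gc'' o).1.
case: o x => x; move: (ilim_map _ c) (ilim_map _ c') (ilim_map _ c'') => S S' S''.
  move=> S''P S'P SP; apply: lim_ext => l _.
  have [k Blk] := sysmorB gc' l; have [j Bkj] := sysmorB gc k.
  have [i [y [ij _ xj]]] := col_rep lawN j ((x : lim (limcolim_diag N)) j).
  have [i' [Ai i'k]] := sysmorA_le lawM gc i k.
  have [u cu] := sysmor_ex gc i'k ij Ai Bkj.
  have [l' [Al' l'l]] := sysmorA_le lawL gc' i' l.
  have [v cv] := sysmor_ex gc' l'l i'k Al' Blk.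
  have [w cw wE] := compc ij i'k l'l cu cv.
  have Sx := SP x _ _ _ _ _ _ i'k ij cu xj.
  rewrite (S''P x _ _ _ _ _ _ l'l ij cw xj) wE.
  by rewrite (S'P (S x) _ _ _ _ _ _ l'l i'k cv Sx).
move=> S''P S'P SP; pose S0 : {linear colimlim N -> colimlim L} := S' \o S.
apply: (@colim_linear_eq _ _ _ S'' S0) => i f _ /=.
have [i' Ai] := sysmorA gc i; have [g gP] := row_image_exists lawN lawM gc f Ai.
have [l' Al'] := sysmorA gc' i'; have [h hP] := row_image_exists lawM lawL gc' g Al'.
rewrite (SP i f i' g); last exact: (row_imageP lawN gc Ai gP).
rewrite (S'P i' g l' h); last exact: (row_imageP lawM gc' Al' hP).
apply: S''P => l l'l.
have [k [i'k [v cv ->]]] := row_imageP lawM gc' Al' hP l'l.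
have [j [ij [u cu ->]]] := row_imageP lawN gc Ai gP i'k.
have [w cw wE] := compc ij i'k l'l cu cv.
by exists j; split=> //; exists w; rewrite ?wE.
Qed.

End SysmorComposition.

Section SysmorIdentity.
Variables (K : pzRingType) (N : bisys K).
Variables (A B : bidx N -> bidx N -> Prop) (c : components N N).
Arguments c : clear implicits.
Hypotheses (lawN : bilaw N) (gc : sysmor A B c).
Hypothesis idc : forall i j, ble i j -> exists2 u, c i j i j u & u =1 id.

Lemma sysmor_id o x : ilim_map o c x = x.
Proof.
have := ilim_map_spec (sysmor_determined lawN lawN gc o).1.
case: o x => x; move: (ilim_map _ c) => S SP.
  apply: lim_ext => j _.
  have [i [y [ij _ xj]]] := col_rep lawN j ((x : lim (limcolim_diag N)) j).
  have [u cu uE] := idc ij.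
  by rewrite (SP x _ _ _ _ _ _ ij ij cu xj) uE xj.
apply: (@colim_linear_eq _ (colimlim_diag N) _ S idfun) => i f _ /=.
apply: SP => k ik; exists k; split=> //.
by have [u cu uE] := idc ik; exists u; rewrite ?uE.
Qed.

End SysmorIdentity.

(** * Diagonal families *)
Section Diagonal.
Variables (K : pzRingType) (I : Type) (le : I -> I -> Prop).

Section OneMap.
Variables (Nm Mm : I -> I -> lmodType K).
Variables (Nb : forall i j k l, {linear Nm k l -> Nm i j}).
Variables (Mb : forall i j k l, {linear Mm k l -> Mm i j}).
Let N := Bisys le Nb.
Let M := Bisys le Mb.
Variable u : forall i j, {linear Nm i j -> Mm i j}.
Arguments u : clear implicits.
Arguments Nb : clear implicits.
Arguments Mb : clear implicits.

Definition diag_natural := forall i j k l, le i j -> le k l -> le i k -> le j l ->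
  forall x, u i j (Nb i j k l x) = Mb i j k l (u k l x).

Definition diag_components : components N M :=
  @diag I (fun i' k i j => {linear Nm i j -> Mm i' k}) u.

Definition diag_map o : {linear ilim o N -> ilim o M} := ilim_map o diag_components.

(** A diagonal family is not closed in the sense of [sysmor], but its composites
    with the transition maps form a closed family that contains it. *)
Definition diag_closure : components N M := fun i' k i j =>
  [set w | [/\ le i' i, le k j & forall x, w x = Mb i' k i j (u i j x)]].

Hypotheses (lawN : bilaw N) (lawM : bilaw M) (unat : diag_natural).

Lemma diag_closure_sysmor : sysmor (N := N) (M := M) le le diag_closure.
Proof.
have tr := @ble_trans _ _ lawM; have rf := ble_refl lawM.
split=> //=.
- by move=> i; exists i; exact: rf.
- by move=> k; exists k; exact: rf.
- by move=> i' i i2' /= i'i i2i; exact: tr i'i.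
- by move=> i' i i2 /= i'i; exact: tr i'i.
- by move=> k j k2 /= kj k2k; exact: tr kj.
- by move=> k j j2 /= kj; exact: tr kj.
- by move=> i' k i j i'k ij i'i kj; exists (Mb i' k i j \o u i j).
- by move=> i' k i j w _ _ [].
move=> i' k i j w i2' k2 i2 j2 w2 i'k ij i2k2 ij2 [i'i kj wE] [i2i2 k2j2 w2E].
move=> i2i' k2k i2i j2j x; rewrite w2E wE unat //.
by rewrite !(bmap_comp lawM).
Qed.

Lemma diag_map_spec o : ispec diag_components (diag_map o).
Proof.
apply: ilim_map_spec; have [[S SP] _] := sysmor_determined lawN lawM diag_closure_sysmor o.
exists S; apply: ispec_sub SP => i' k i j i'k ij w cw; case: cw i'k ij => i0 j0 ij _.
by split=> [||x]; rewrite ?(bmap_id lawM) //; exact: (ble_refl lawM).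
Qed.

Lemma diag_map_lc (f : lim (limcolim_diag N)) i j x : le i j ->
  f j = @colim_in _ (@col_diag _ N j) i x ->
  (diag_map LimColim f : lim (limcolim_diag M)) j
    = @colim_in _ (@col_diag _ M j) i (u i j x).
Proof.
move=> ij fj; apply: (@diag_map_spec LimColim f i j i j (u i j) x ij ij _ fj).
exact: (Diag u).
Qed.

Lemma diag_map_cl i (f : lim (@row_diag _ N i)) (g : lim (@row_diag _ M i)) :
  (forall k, le i k -> g k = u i k (f k)) ->
  diag_map ColimLim (@colim_in _ (colimlim_diag N) i f) =
  @colim_in _ (colimlim_diag M) i g.
Proof.
move=> gf; apply: (@diag_map_spec ColimLim i f i g) => k ik; exists k; split=> //.
by exists (u i k); [exact: (Diag u)|exact: gf].
Qed.

Lemma diag_map_row i (f : lim (@row_diag _ N i)) :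
  exists g : lim (@row_diag _ M i), forall k, le i k -> g k = u i k (f k).
Proof.
have [|||g gP] := @lim_make _ (@row_diag _ M i) (fun k y => y = u i k (f k)).
- by move=> k _; exists (u i k (f k)).
- by move=> k _ y y' -> ->.
- move=> k l [/= ik il lk] y ->; rewrite -unat //; last exact: (ble_refl lawM).
  by rewrite (row_lim_map lawN f (j := l) (k := k)).
by exists g.
Qed.

End OneMap.

Section Composition.
Variables (Nm Mm Lm : I -> I -> lmodType K).
Variables (Nb : forall i j k l, {linear Nm k l -> Nm i j}).
Variables (Mb : forall i j k l, {linear Mm k l -> Mm i j}).
Variables (Lb : forall i j k l, {linear Lm k l -> Lm i j}).
Let N := Bisys le Nb.
Let M := Bisys le Mb.
Let L := Bisys le Lb.
Variables (u : forall i j, {linear Nm i j -> Mm i j}).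
Variables (v : forall i j, {linear Mm i j -> Lm i j}).
Variables (w : forall i j, {linear Nm i j -> Lm i j}).
Arguments u : clear implicits.
Arguments v : clear implicits.
Arguments w : clear implicits.
Hypotheses (lawN : bilaw N) (lawM : bilaw M) (lawL : bilaw L).
Hypotheses (unat : diag_natural Nb Mb u) (vnat : diag_natural Mb Lb v).
Hypothesis vu : forall i j, le i j -> forall x, v i j (u i j x) = w i j x.

Lemma diag_map_comp o x : diag_map Mb Lb v o (diag_map Nb Mb u o x) = diag_map Nb Lb w o x.
Proof.
have wnat : diag_natural Nb Lb w.
  by move=> i j k l ij kl ik jl y; rewrite -!vu // unat // vnat.
case: o x => x.
  apply: lim_ext => j _.
  have [i [y [ij _ xj]]] := col_rep lawN j ((x : lim (limcolim_diag N)) j).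
  rewrite (diag_map_lc lawN lawL wnat ij xj) -vu //.
  by rewrite (diag_map_lc lawM lawL vnat ij (diag_map_lc lawN lawM unat ij xj)).
pose S0 : {linear colimlim N -> colimlim L} :=
  diag_map Mb Lb v ColimLim \o diag_map Nb Mb u ColimLim.
apply: (@colim_linear_eq _ (colimlim_diag N) _ S0 (diag_map Nb Lb w ColimLim)) => i f _ /=.
have [g gP] := diag_map_row lawN lawM unat f; have [h hP] := diag_map_row lawM lawL vnat g.
rewrite (diag_map_cl lawN lawM unat gP) (diag_map_cl lawM lawL vnat hP).
by rewrite (diag_map_cl (g := h) lawN lawL wnat) // => k ik; rewrite hP // gP // vu.
Qed.

End Composition.

Section Identity.
Variables (Nm : I -> I -> lmodType K).
Variables (Nb : forall i j k l, {linear Nm k l -> Nm i j}).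
Let N := Bisys le Nb.
Variables (u : forall i j, {linear Nm i j -> Nm i j}).
Arguments u : clear implicits.
Hypotheses (lawN : bilaw N) (uid : forall i j, le i j -> forall x, u i j x = x).

Lemma diag_map_id o x : diag_map Nb Nb u o x = x.
Proof.
have unat : diag_natural Nb Nb u by move=> i j k l ij kl _ _ y; rewrite !uid.
case: o x => x.
  apply: lim_ext => j _.
  have [i [y [ij _ xj]]] := col_rep lawN j ((x : lim (limcolim_diag N)) j).
  by rewrite (diag_map_lc lawN lawN unat ij xj) uid // xj.
apply: (@colim_linear_eq _ (colimlim_diag N) _ (diag_map Nb Nb u ColimLim) idfun) => i f _ /=.
by rewrite (diag_map_cl (g := f) lawN lawN unat) // => k ik; rewrite uid.
Qed.

End Identity.
End Diagonal.

Arguments diag_map {K I} le {Nm Mm} Nb Mb u o.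
Arguments diag_natural {K I} le {Nm Mm} Nb Mb u.

Section DiagonalIso.
Variables (K : pzRingType) (I : Type) (le : I -> I -> Prop).
Variables (Nm Mm : I -> I -> lmodType K).
Variables (Nb : forall i j k l, {linear Nm k l -> Nm i j}).
Variables (Mb : forall i j k l, {linear Mm k l -> Mm i j}).
Let N := Bisys le Nb.
Let M := Bisys le Mb.
Variable u : forall i j, {linear Nm i j -> Mm i j}.
Arguments u : clear implicits.
Hypotheses (lawN : bilaw N) (unat : diag_natural le Nb Mb u).
Hypothesis ubij : forall i j, le i j -> bijective (u i j).

(** This is how the systems of the duals acquire their laws: from those of the
    module, through the Fourier transforms of the quotients. *)
Lemma diag_iso_law : bilaw M.
Proof.
case: lawN => rf tr lo up nid ncomp; split=> //.
- move=> i j ij x; have [v _ vK] := ubij ij; rewrite -[x]vK /= -unat //; try exact: rf.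
  by congr (u _ _ _); exact: nid.
- move=> i j k l m n ij kl mn ik km jl ln x; have [v _ vK] := ubij mn.
  have im := tr _ _ _ ik km; have jn := tr _ _ _ jl ln.
  by rewrite -[x]vK /= -!unat //; congr (u _ _ _); exact: ncomp.
Qed.

Lemma diag_iso_inverse : exists v : forall i j, {linear Mm i j -> Nm i j},
  [/\ diag_natural le Mb Nb v, forall i j, le i j -> forall x, v i j (u i j x) = x &
      forall i j, le i j -> forall x, u i j (v i j x) = x].
Proof.
have ex i j : exists v : {linear Mm i j -> Nm i j},
    le i j -> cancel (u i j) v /\ cancel v (u i j).
  have [ij|nij] := pselect (le i j); last by exists \0.
  by have [v vP] := inv_linear (ubij ij); exists v.
pose v i j := projT1 (cid (ex i j)).
have vP i j : le i j -> cancel (u i j) (v i j) /\ cancel (v i j) (u i j).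
  exact: projT2 (cid (ex i j)).
exists v; split=> [i j k l ij kl ik jl x|i j ij|i j ij].
- by apply: (can_inj (vP i j ij).1); rewrite unat // (vP i j ij).2 (vP k l kl).2.
- exact: (vP i j ij).1.
- exact: (vP i j ij).2.
Qed.

Lemma diag_map_bij o : bijective (diag_map le Nb Mb u o).
Proof.
have lawM := diag_iso_law; have [v [vnat vu uv]] := diag_iso_inverse.
exists (diag_map le Mb Nb v o) => x.
  by rewrite (diag_map_comp (w := fun i j => idfun) lawN lawM lawN unat vnat) // diag_map_id.
by rewrite (diag_map_comp (w := fun i j => idfun) lawM lawN lawM vnat unat) // diag_map_id.
Qed.

End DiagonalIso.

(** * Transport along an isomorphism of systems *)
Section TransportSpecification.
Variables (K : pzRingType) (o : flavour).
Variables (I J : Type) (le : I -> I -> Prop) (le' : J -> J -> Prop).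
Variables (Nm Nm' : I -> I -> lmodType K) (Mm Mm' : J -> J -> lmodType K).
Variables (Nb : forall i j k l, {linear Nm k l -> Nm i j}).
Variables (Nb' : forall i j k l, {linear Nm' k l -> Nm' i j}).
Variables (Mb : forall i j k l, {linear Mm k l -> Mm i j}).
Variables (Mb' : forall i j k l, {linear Mm' k l -> Mm' i j}).
Let N := Bisys le Nb.
Let N' := Bisys le Nb'.
Let M := Bisys le' Mb.
Let M' := Bisys le' Mb'.

Variables (u' : forall i j, {linear Nm' i j -> Nm i j}).
Variables (v : forall i j, {linear Mm i j -> Mm' i j}).
Variables (v' : forall i j, {linear Mm' i j -> Mm i j}).
Arguments u' : clear implicits.
Arguments v : clear implicits.
Arguments v' : clear implicits.
Hypotheses (lawN : bilaw N) (lawN' : bilaw N') (lawM : bilaw M) (lawM' : bilaw M').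
Hypotheses (unat : diag_natural le Nb' Nb u') (vnat : diag_natural le' Mb Mb' v).
Hypothesis vnat' : diag_natural le' Mb' Mb v'.
Hypothesis vK : forall i j, le' i j -> forall x, v' i j (v i j x) = x.
Hypothesis vK' : forall i j, le' i j -> forall x, v i j (v' i j x) = x.
Variables (c : components N M) (c' : components N' M').
Arguments c : clear implicits.
Arguments c' : clear implicits.
Hypothesis cc' : forall i' k i j, le' i' k -> le i j ->
  forall w', c' i' k i j w' -> exists2 w, c i' k i j w &
    forall x, v i' k (w (u' i j x)) = w' x.

Lemma transport_spec (S : {linear ilim o N -> ilim o M}) : ispec c S ->
  ispec c' (diag_map le' Mb Mb' v o \o S \o diag_map le Nb' Nb u' o).
Proof.
case: o S => S SP.
  move=> f i' k i j w' x i'k ij cw' fj /=.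
  have [w cw wE] := cc' i'k ij cw'.
  have Uf := diag_map_lc lawN' lawN unat ij fj.
  by rewrite (diag_map_lc lawM lawM' vnat i'k (SP _ _ _ _ _ _ _ i'k ij cw Uf)) wE.
move=> i f i' g gf /=.
have [f0 f0P] := diag_map_row lawN' lawN unat f.
have [g0 g0P] := diag_map_row lawM' lawM vnat' g.
rewrite (diag_map_cl lawN' lawN unat f0P) (SP i f0 i' g0).
  by rewrite (diag_map_cl (g := g) lawM lawM' vnat) // => k ik; rewrite g0P // vK'.
move=> k i'k; have [j [ij [w' cw' gk]]] := gf k i'k.
have [w cw wE] := cc' i'k ij cw'.
exists j; split=> //; exists w => //.
by rewrite g0P // gk -wE vK // f0P.
Qed.

End TransportSpecification.

Section Transport.
Variables (K : pzRingType) (o : flavour).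
Variables (I J : Type) (le : I -> I -> Prop) (le' : J -> J -> Prop).
Variables (Nm Nm' : I -> I -> lmodType K) (Mm Mm' : J -> J -> lmodType K).
Variables (Nb : forall i j k l, {linear Nm k l -> Nm i j}).
Variables (Nb' : forall i j k l, {linear Nm' k l -> Nm' i j}).
Variables (Mb : forall i j k l, {linear Mm k l -> Mm i j}).
Variables (Mb' : forall i j k l, {linear Mm' k l -> Mm' i j}).
Let N := Bisys le Nb.
Let N' := Bisys le Nb'.
Let M := Bisys le' Mb.
Let M' := Bisys le' Mb'.


Variables (u : forall i j, {linear Nm i j -> Nm' i j}).
Variables (v : forall i j, {linear Mm i j -> Mm' i j}).
Arguments u : clear implicits.
Arguments v : clear implicits.
Hypotheses (lawN : bilaw N) (lawM : bilaw M).
Hypotheses (unat : diag_natural le Nb Nb' u) (vnat : diag_natural le' Mb Mb' v).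
Hypothesis ubij : forall i j, le i j -> bijective (u i j).
Hypothesis vbij : forall i j, le' i j -> bijective (v i j).
Variables (c : components N M) (c' : components N' M').
Arguments c : clear implicits.
Arguments c' : clear implicits.
Hypothesis cc' : forall i' k i j, le' i' k -> le i j ->
  forall w, c i' k i j w -> exists2 w', c' i' k i j w' &
    forall x, w' (u i j x) = v i' k (w x).
Hypothesis c'c : forall i' k i j, le' i' k -> le i j ->
  forall w', c' i' k i j w' -> exists2 w, c i' k i j w &
    forall x, w' (u i j x) = v i' k (w x).

(** Conjugation by the isomorphisms exchanges the solutions of the two
    specifications, so that either has a unique solution when the other has. *)
Lemma transport : determined o c -> determined o c' /\
  forall x, ilim_map o c' (diag_map le Nb Nb' u o x) =
            diag_map le' Mb Mb' v o (ilim_map o c x).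
Proof.
move=> [/ilim_map_spec SP Su].
have lawN' := diag_iso_law lawN unat ubij; have lawM' := diag_iso_law lawM vnat vbij.
have [u' [unat' uK uK']] := diag_iso_inverse unat ubij.
have [v' [vnat' vK vK']] := diag_iso_inverse vnat vbij.
have S1P := transport_spec lawN lawN' lawM lawM' unat' vnat vnat' vK vK' (c := c)
  (c' := c') _ SP.
have {}S1P := S1P (fun i' k i j i'k ij w' cw' =>
  let: ex_intro2 w cw wE := c'c i'k ij cw' in
  ex_intro2 _ _ w cw (fun x => etrans (esym (wE (u' i j x))) (congr1 w' (uK' i j ij x)))).
have S2P S : ispec c' S -> ispec c (diag_map le' Mb' Mb v' o \o S \o diag_map le Nb Nb' u o).
  move=> S'P; have := transport_spec lawN' lawN lawM' lawM unat vnat' vnat vK' vK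
    (c := c') (c' := c) _ S'P; apply.
  move=> i' k i j i'k ij w cw; have [w' cw' wE] := cc' i'k ij cw.
  by exists w' => // x; rewrite wE vK.
have vvK y : diag_map le' Mb Mb' v o (diag_map le' Mb' Mb v' o y) = y.
  by rewrite (diag_map_comp (w := fun i j => idfun) lawM' lawM lawM' vnat' vnat) //
    diag_map_id.
have uuK y : diag_map le Nb Nb' u o (diag_map le Nb' Nb u' o y) = y.
  by rewrite (diag_map_comp (w := fun i j => idfun) lawN' lawN lawN' unat' unat) //
    diag_map_id.
have uuK' y : diag_map le Nb' Nb u' o (diag_map le Nb Nb' u o y) = y.
  by rewrite (diag_map_comp (w := fun i j => idfun) lawN lawN' lawN unat unat') // diag_map_id.
have uniq S : ispec c' S -> 
    S =1 diag_map le' Mb Mb' v o \o ilim_map o c \o diag_map le Nb' Nb u' o.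
  move=> S'P x /=; rewrite -(Su _ _ (S2P S S'P) SP) /=.
  by rewrite vvK uuK.
split.
  split; first by eexists; exact: S1P.
  by move=> S S' /uniq SE /uniq S'E x; rewrite SE S'E.
move=> x; rewrite (uniq (ilim_map o c')) /= ?uuK' //.
by apply: ilim_map_spec; eexists; exact: S1P.
Qed.

End Transport.

(** * Morphisms between strong objects *)
Section Morphisms.
Variable R : comPzRingType.
Implicit Types (n m : nat).

Lemma mlin_canon n (X Y : mob (level R n)) (phi : {linear mmod X -> mmod Y}) :
  mlin (canon phi) = phi.
Proof. by case: n X Y phi. Qed.

Section Filtered.
Variable m : nat.
Implicit Types X Y Z : filtered (level R m).

Lemma fnatP X (i j k l : fidx X) : isobj (n := m.+1) X ->
    (i <= j)%O -> (k <= l)%O -> (i <= k)%O -> (j <= l)%O ->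
  exists chi, [/\ induced (fid X) chi, ismor chi, fnat i j k l = canon chi &
                  mlin (fnat i j k l) = chi].
Proof.
move=> [_ _ nat] ij kl ik jl; have [chi [ichi mchi] e] := nat _ _ _ _ ij kl ik jl.
by exists chi; split=> //; rewrite e mlin_canon.
Qed.

Lemma prj_exists X (i k : fidx X) (a : mmod (fquo i k)) : isobj (n := m.+1) X ->
  (i <= k)%O -> exists x, a = fprj i k x.
Proof.
move=> [fil _ _] ik; have : [set: mmod (fquo i k)] a by [].
by rewrite -(prj_surj fil ik) => -[x _ <-]; exists x.
Qed.

Lemma induced_unique X Y (phi : {linear fmod X -> fmod Y}) (i' k : fidx X)
    (i j : fidx Y) (chi chi' : {linear mmod (fquo i' k) -> mmod (fquo i j)}) :
  isobj (n := m.+1) X -> (i' <= k)%O -> maps_into phi k j ->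
  induced phi chi -> induced phi chi' -> chi = chi'.
Proof.
move=> oX i'k kj ichi ichi'; apply: linear_ext => a.
have [x ->] := prj_exists a oX i'k; have [y xy] := kj x.
by rewrite (ichi x y xy) (ichi' x y xy).
Qed.

Lemma maps_into_trans X Y Z (phi : {linear fmod X -> fmod Y})
    (psi : {linear fmod Y -> fmod Z}) i j k :
  maps_into phi i j -> maps_into psi j k -> maps_into (psi \o phi) i k.
Proof.
move=> ij jk x; have [y xy] := ij x; have [z yz] := jk y.
by exists z; rewrite /= xy yz.
Qed.

Lemma maps_into_le X Y (phi : {linear fmod X -> fmod Y}) i' i j j' :
  isobj (n := m.+1) X -> isobj (n := m.+1) Y -> (i' <= i)%O -> (j <= j')%O ->
  maps_into phi i j -> maps_into phi i' j'.
Proof.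
move=> [filX _ _] [filY _ _] i'i jj' ij x.
have [x' /= xx'] := sub_mono filX i'i x; have [y x'y] := ij x'.
have [z /= yz] := sub_mono filY jj' y.
by exists z; rewrite xx' x'y yz.
Qed.

Lemma induced_comp X Y Z (phi : {linear fmod X -> fmod Y})
    (psi : {linear fmod Y -> fmod Z}) (i' k : fidx X) (i j : fidx Y) (p q : fidx Z)
    (chi : {linear mmod (fquo i' k) -> mmod (fquo i j)})
    (chi' : {linear mmod (fquo i j) -> mmod (fquo p q)}) :
  maps_into phi k j ->
  induced phi chi -> induced psi chi' -> induced (psi \o phi) (chi' \o chi).
Proof.
move=> kj ichi ichi' x z /= xz; have [y xy] := kj x.
by rewrite (ichi x y xy); apply: ichi'; rewrite -xy.
Qed.

(** By definition phi induces a morphism F(k)/F(i1) -> G(j1)/G(i) only for i1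
    small and j1 large.  As A is strong, F(k)/F(i') is the cokernel of
    F(i')/F(i1) -> F(k)/F(i1), so that this morphism factors through it; as B is
    strong, G(j)/G(i) is the kernel of G(j1)/G(i) -> G(j1)/G(j), and it
    factors through that as well. *)
Lemma induced_ismor X Y (phi : {linear fmod X -> fmod Y}) (i' k : fidx X)
    (i j : fidx Y) :
    sobj (n := m.+1) X -> sobj (n := m.+1) Y -> @ismor R m.+1 X Y phi ->
    (i' <= k)%O -> (i <= j)%O -> maps_into phi i' i -> maps_into phi k j ->
  exists chi : {linear mmod (fquo i' k) -> mmod (fquo i j)},
    induced phi chi /\ ismor chi.
Proof.
move=> [oX [_ exX]] [oY [_ exY]] mphi i'k ij i'i kj.
have [filX quoX _] := oX; have [filY quoY _] := oY.
have [i0 [j0 [i0k ij0 mor]]] := mphi k i.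
have [i1 [i1i0 i1i']] := idx_lower filX i0 i'.
have [j1 [j0j1 jj1]] := idx_upper filY j0 j.
have i1k := le_trans i1i' i'k; have ij1 := le_trans ij jj1.
have [_ kj1 [chi1 ichi1 mchi1]] := mor i1 j1 i1i0 j0j1.
have [_ [_ _ _ coker]] := exX i1 i' k i1i' i'k.
have [[_ _ _ ker] _] := exY i j j1 ij jj1.
have [al [ial _ _ eal]] := fnatP oX i1i' i1k (lexx i1) i'k.
have [pi [ipi _ _ epi]] := fnatP oX i1k i'k i1i' (lexx k).
have [al' [ial' _ _ eal']] := fnatP oY ij ij1 (lexx i) jj1.
have [pi' [ipi' _ _ epi']] := fnatP oY ij1 jj1 ij (lexx j1).
rewrite eal epi in coker; rewrite eal' epi' in ker.
have chi1al : chi1 \o al =1 \0.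
  move=> a /=; have [x ->] := prj_exists a oX i1i'.
  have [y /= xy] := sub_mono filX i'k x; rewrite (ial x y xy).
  have [z yz] := kj1 y; rewrite (ichi1 y z yz).
  apply/(prj_ker filY ij1); have [w xw] := i'i x.
  by exists w => //; rewrite -yz -xy.
have [sg [msg sgpi _]] := coker _ chi1 (quoY _ _ ij1) mchi1 chi1al.
have sgE x z : phi (finc k x) = finc j1 z -> sg (fprj i' k x) = fprj i j1 z.
  by move=> xz; rewrite -(ipi x x) //; move: (sgpi (fprj i1 k x)) => /= ->; exact: ichi1.
have pisg : pi' \o sg =1 \0.
  move=> a /=; have [x ->] := prj_exists a oX i'k.
  have [z xz] := kj1 x; rewrite (sgE x z xz) (ipi' z z) //.
  apply/(prj_ker filY jj1); have [w xw] := kj x.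
  by exists w => //; rewrite -xw xz.
have [tau [mtau altau _]] := ker _ sg (quoX _ _ i'k) msg pisg.
exists tau; split=> // x y xy; apply/eqP; rewrite -subr_eq0; apply/eqP.
have [z /= yz] := sub_mono filY jj1 y.
have [w xw] := kj x.
have inj b : al' b = 0 -> b = 0.
  have [v ->] := prj_exists b oY ij; have [v' /= vv'] := sub_mono filY jj1 v.
  rewrite (ial' v v' vv') => /(prj_ker filY ij1)[t _ tv].
  by apply/(prj_ker filY ij); exists t => //; rewrite tv -vv'.
apply: inj; rewrite linearB /= (ial' y z yz) -(sgE x z) ?xy //.
by move: (altau (fprj i' k x)) => /= ->; rewrite subrr.
Qed.

End Filtered.

Lemma ismor_id n (X : mob (level R n)) : isobj X -> ismor (@idfun (mmod X)).
Proof.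
case: n X => [//|m] X oX i j; have [fil _ _] := oX.
have [i0 [i0i i0j]] := idx_lower fil i j; have [j0 [ij0 jj0]] := idx_upper fil i j.
exists i0, j0; split=> // i' j' i'i0 j0j'.
have i'i := le_trans i'i0 i0i; have i'j := le_trans i'i0 i0j.
have ij' := le_trans ij0 j0j'; have jj' := le_trans jj0 j0j'.
have [chi [ichi mchi _ _]] := fnatP oX i'i jj' i'j ij'.
by split; [exact: sub_mono|exact: sub_mono|exists chi].
Qed.

Section Index.
Variable m : nat.
Implicit Types X Y Z : filtered (level R m).

Lemma idx_inhabited X : isobj (n := m.+1) X -> exists i : fidx X, True.
Proof. by move=> [fil _ _]; have [i _] := sub_cup fil 0; exists i. Qed.

Lemma ismor_lower X Y (phi : {linear fmod X -> fmod Y}) (i : fidx Y) :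
  isobj (n := m.+1) X -> @ismor R m.+1 X Y phi -> exists i', maps_into phi i' i.
Proof.
move=> /idx_inhabited[k _] mphi; have [i0 [j0 [_ _ mor]]] := mphi k i.
by have [h _ _] := mor i0 j0 (lexx _) (lexx _); exists i0.
Qed.

Lemma ismor_upper X Y (phi : {linear fmod X -> fmod Y}) (k : fidx X) :
  isobj (n := m.+1) Y -> @ismor R m.+1 X Y phi -> exists j, maps_into phi k j.
Proof.
move=> /idx_inhabited[i _] mphi; have [i0 [j0 [_ _ mor]]] := mphi k i.
by have [_ h _] := mor i0 j0 (lexx _) (lexx _); exists j0.
Qed.

End Index.

(** Composing the induced morphisms requires one and the same quotient of the
    middle filtration for both; [induced_ismor] leaves the choice of its two
    indices free. *)
Lemma ismor_comp n (X Y Z : mob (level R n)) (phi : {linear mmod X -> mmod Y})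
    (psi : {linear mmod Y -> mmod Z}) :
  sobj X -> sobj Y -> sobj Z -> ismor phi -> ismor psi -> ismor (psi \o phi).
Proof.
elim: n X Y Z phi psi => [//|m IH] X Y Z phi psi sX sY sZ mphi mpsi i j.
have [oX [qX _]] := sX; have [oY [qY _]] := sY; have [oZ [qZ _]] := sZ.
have [filX quoX _] := oX; have [filY quoY _] := oY; have [filZ quoZ _] := oZ.
have [k ik] := ismor_upper i oY mphi; have [k1 k1j] := ismor_lower j oY mpsi.
have [k' [k'k k'k1]] := idx_lower filY k k1.
have [i1 i1k'] := ismor_lower k' oX mphi; have [j1 kj1] := ismor_upper k oZ mpsi.
have [i0 [i0i i0i1]] := idx_lower filX i i1; have [j0 [jj0 j1j0]] := idx_upper filZ j j1.
exists i0, j0; split=> // i' j' i'i0 j0j'.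
have i'k' : maps_into phi i' k' by apply: maps_into_le i1k' => //; exact: le_trans i0i1.
have k'j : maps_into psi k' j by exact: maps_into_le k1j.
have kj' : maps_into psi k j' by apply: maps_into_le kj1 => //; exact: le_trans j0j'.
have i'i := le_trans i'i0 i0i; have jj' := le_trans jj0 j0j'.
have [chi [ichi mchi]] := induced_ismor sX sY mphi i'i k'k i'k' ik.
have [chi' [ichi' mchi']] := induced_ismor sY sZ mpsi k'k jj' k'j kj'.
split; [exact: maps_into_trans k'j|exact: maps_into_trans kj'|].
exists (chi' \o chi); first exact: induced_comp ichi'.
apply: IH => //; split; [exact: quoX|exact: qX|exact: quoY|exact: qY|exact: quoZ|exact: qZ].
Qed.

Lemma sobj_quo m (X : filtered (level R m)) (i j : fidx X) :
  sobj (n := m.+1) X -> (i <= j)%O -> sobj (fquo i j).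
Proof. by move=> [[_ quo _] [st _]] ij; split; [exact: quo|exact: st]. Qed.

End Morphisms.

(** * Function spaces as functors on the strong objects *)
Section Functoriality.
Variables (R : comPzRingType) (K : pzRingType).

(** The morphisms range over all those of A_n between strong objects, because the
    maps that a strong morphism induces between the quotients are morphisms of
    A_n, but not obviously strong. *)
Record cofunctorial n (F : cofunctor K (level R n)) : Prop := Cofunctorial {
  co_id : forall X : mob (level R n), sobj X ->
    forall x, cmap F (canon (@idfun (mmod X) : {linear _ -> _})) x = x;
  co_comp : forall (X Y Z : mob (level R n)) (phi : {linear mmod X -> mmod Y})
      (psi : {linear mmod Y -> mmod Z}),
    sobj X -> sobj Y -> sobj Z -> ismor phi -> ismor psi ->
    forall x, cmap F (canon (psi \o phi : {linear _ -> _})) x =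
              cmap F (canon phi) (cmap F (canon psi) x) }.

Record vfunctorial n (G : functor K (level R n)) : Prop := Vfunctorial {
  v_id : forall X : mob (level R n), sobj X ->
    forall x, vmap G (canon (@idfun (mmod X) : {linear _ -> _})) x = x;
  v_comp : forall (X Y Z : mob (level R n)) (phi : {linear mmod X -> mmod Y})
      (psi : {linear mmod Y -> mmod Z}),
    sobj X -> sobj Y -> sobj Z -> ismor phi -> ismor psi ->
    forall x, vmap G (canon (psi \o phi : {linear _ -> _})) x =
              vmap G (canon psi) (vmap G (canon phi) x) }.

Section Components.
Variable m : nat.
Implicit Types X Y Z : filtered (level R m).

Lemma fnat_id X (i j : fidx X) : sobj (n := m.+1) X -> (i <= j)%O ->
  fnat i j i j = canon (@idfun (mmod (fquo i j)) : {linear _ -> _}).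
Proof.
move=> [oX _] ij; have [chi [ichi _ -> _]] := fnatP oX ij ij (lexx i) (lexx j).
have [fil _ _] := oX; congr canon; apply: (induced_unique (phi := fid X) oX ij _ ichi).
  exact: sub_mono.
by move=> x y /= /(Defs.inc_inj fil) ->.
Qed.

Lemma fnat_comp X (i j k l p q : fidx X) : sobj (n := m.+1) X ->
    (i <= j)%O -> (k <= l)%O -> (p <= q)%O ->
    (i <= k)%O -> (k <= p)%O -> (j <= l)%O -> (l <= q)%O ->
  exists chi chi', [/\ ismor chi, ismor chi', fnat i j k l = canon chi,
    fnat k l p q = canon chi' &
    fnat i j p q = canon (chi' \o chi : {linear _ -> _})].
Proof.
move=> [oX _] ij kl pq ik kp jl lq; have [fil _ _] := oX.
have [chi [ichi mchi e _]] := fnatP oX ij kl ik jl.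
have [chi' [ichi' mchi' e' _]] := fnatP oX kl pq kp lq.
have [chi2 [ichi2 _ e2 _]] := fnatP oX ij pq (le_trans ik kp) (le_trans jl lq).
exists chi, chi'; split=> //; rewrite e2; congr canon.
apply: (induced_unique (phi := fid X) oX ij _ ichi2).
  by apply: sub_mono => //; exact: le_trans lq.
by apply: induced_comp ichi ichi'; exact: sub_mono.
Qed.

Variables (X Y : filtered (level R m)) (phi : {linear fmod X -> fmod Y}).
Hypotheses (sX : sobj (n := m.+1) X) (sY : sobj (n := m.+1) Y).
Hypothesis mphi : @ismor R m.+1 X Y phi.

Let hcanon i' k i j := @hcomp _ _ X Y (@canon R m.+1 X Y phi) i' k i j.

Lemma canon_comp_exists i' k i j : (i' <= k)%O -> (i <= j)%O ->
  maps_into phi i' i -> maps_into phi k j ->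
  exists chi : {linear mmod (fquo i' k) -> mmod (fquo i j)},
    hcanon (canon chi).
Proof.
move=> i'k ij i'i kj; have [chi chiP] := induced_ismor sX sY mphi i'k ij i'i kj.
by exists chi; split=> //; exists chi.
Qed.

(** Both composites are induced by phi, and phi induces at most one map. *)
Lemma canon_comp_natural i' k i j h i2' k2 i2 j2 h2 :
    @hcanon i' k i j h -> @hcanon i2' k2 i2 j2 h2 ->
    (i2' <= i')%O -> (k2 <= k)%O -> (i2 <= i)%O -> (j2 <= j)%O ->
  exists chi chi2 mu nu,
    [/\ h = canon chi, h2 = canon chi2, fnat i2' k2 i' k = canon mu &
        fnat i2 j2 i j = canon nu] /\
    [/\ ismor chi, ismor chi2, ismor mu & ismor nu] /\
    nu \o chi2 = chi \o mu :> {linear _ -> _}.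
Proof.
move=> [i'k ij i'i kj [chi [ichi mchi] ->]] [i2k2 ij2 i2i k2j2 [chi2 [ichi2 mchi2] ->]].
move=> i2i' k2k i2i_ j2j; have [oX _] := sX; have [oY _] := sY.
have [filX _ _] := oX; have [filY _ _] := oY.
have [mu [imu mmu emu _]] := fnatP oX i2k2 i'k i2i' k2k.
have [nu [inu mnu enu _]] := fnatP oY ij2 ij i2i_ j2j.
exists chi, chi2, mu, nu; do 2!split=> //.
apply: (induced_unique (phi := phi) oX i2k2).
- exact: maps_into_le k2j2.
- have := induced_comp k2j2 ichi2 inu; exact.
- by have := induced_comp (sub_mono filX k2k) imu ichi; exact.
Qed.

End Components.

Section CovariantStep.
Variables (m : nat) (o : flavour) (G : functor K (level R m)).
Hypothesis Gf : vfunctorial G.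

Lemma vsys_law (X : filtered (level R m)) : sobj (n := m.+1) X -> bilaw (vsys G X).
Proof.
move=> sX; have [[fil _ _] _] := sX; split=> /=.
- exact: lexx.
- by move=> j i k ji kj; exact: le_trans ji.
- by move=> i j; have [k []] := idx_upper fil i j; exists k.
- by move=> i j; have [k []] := idx_lower fil i j; exists k.
- by move=> j i ij x; rewrite fnat_id // (v_id Gf) //; exact: sobj_quo.
move=> j i l k q p ij kl pq lj ql ki pk x.
have [chi [chi' [mchi mchi' -> -> ->]]] := fnat_comp sX pq kl ij pk ki ql lj.
by rewrite (v_comp Gf) //; exact: sobj_quo.
Qed.

Lemma vcomp_sysmor (X Y : filtered (level R m)) (phi : {linear fmod X -> fmod Y}) :
    sobj (n := m.+1) X -> sobj (n := m.+1) Y -> @ismor R m.+1 X Y phi ->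
  sysmor (N := vsys G X) (M := vsys G Y) (fun j k => maps_into phi k j)
    (fun i i' => maps_into phi i' i) (@vcomp _ _ _ G X Y (@canon R m.+1 X Y phi)).
Proof.
move=> sX sY mphi; have [oX _] := sX; have [oY _] := sY; split=> /=.
- by move=> k; exact: ismor_upper.
- by move=> i; exact: ismor_lower.
- by move=> j k j2 kj jj2; exact: maps_into_le kj.
- by move=> j k k2 kj k2k; exact: maps_into_le kj.
- by move=> i i' i2 i'i ii2; exact: maps_into_le i'i.
- by move=> i i' i2 i'i i2i; exact: maps_into_le i'i.
- move=> j i k i' ij i'k kj i'i.
  have [chi chiP] := canon_comp_exists sX sY mphi i'k ij i'i kj.
  by exists (vmap G (canon chi)); exists (canon chi).
- by move=> j i k i' u ij i'k [h [_ _ i'i kj _] _].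
move=> j i k i' u j2 i2 k2 i2' u2 ij i'k ij2 i2k2 [h hP <-] [h2 h2P <-].
move=> jj2 ii2 kk2 ii2' x.
have [chi2 [chi [mu [nu [[-> -> -> ->]]]]]] :=
  canon_comp_natural sX sY h2P hP ii2' kk2 ii2 jj2.
move=> [[mchi2 mchi mmu mnu] E].
by rewrite -!(v_comp Gf) ?E //; exact: sobj_quo.
Qed.

Lemma vstep_functorial : vfunctorial (n := m.+1) (vstep o G).
Proof.
split=> [X sX x|X Y Z phi psi sX sY sZ mphi mpsi x].
  have [oX _] := sX; have [fil _ _] := oX.
  apply: (sysmor_id (vsys_law sX) (vcomp_sysmor sX sX (ismor_id oX))) => j i /= ij.
  exists (vmap G (canon (@idfun (mmod (fquo i j)) : {linear _ -> _}))).
    eexists; last reflexivity; split=> //; [exact: sub_mono|exact: sub_mono|].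
    exists (@idfun (mmod (fquo i j))) => //; split.
      by move=> y z /= /(Defs.inc_inj fil) ->.
    by apply: ismor_id; apply: (sobj_quo sX ij).1.
  by move=> y; rewrite (v_id Gf) //; exact: sobj_quo.
have mcomp := ismor_comp sX sY sZ mphi mpsi.
apply: (sysmor_comp (vsys_law sX) (vsys_law sY) (vsys_law sZ) (vcomp_sysmor sX sY mphi)
  (vcomp_sysmor sY sZ mpsi) (vcomp_sysmor sX sZ mcomp)) => l l' k i' j i u v /= ij i'k l'l.
move=> [_ [_ _ ji' ik [chi [ichi mchi] ->]] <-].
move=> [_ [_ _ i'l' kl [chi' [ichi' mchi'] ->]] <-].
exists (vmap G (canon (chi' \o chi : {linear _ -> _}))); last first.
  by move=> y /=; rewrite (v_comp Gf) //; exact: sobj_quo.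
eexists; last reflexivity; split=> //; try exact: maps_into_trans; first last.
  exists (chi' \o chi) => //; split; first exact: induced_comp ichi'.
  by apply: ismor_comp => //; exact: sobj_quo.
Qed.

End CovariantStep.

Section ContravariantStep.
Variables (m : nat) (o : flavour) (F : cofunctor K (level R m)).
Hypothesis Ff : cofunctorial F.

Lemma cosys_law (X : filtered (level R m)) : sobj (n := m.+1) X -> bilaw (cosys F X).
Proof.
move=> sX; have [[fil _ _] _] := sX; split=> /=.
- exact: lexx.
- by move=> j i k ij jk; exact: le_trans jk.
- exact: idx_lower.
- exact: idx_upper.
- by move=> i j ij x; rewrite fnat_id // (co_id Ff) //; exact: sobj_quo.
move=> i j k l p q ij kl pq ik kp jl lq x.
have [chi [chi' [mchi mchi' -> -> ->]]] := fnat_comp sX ij kl pq ik kp jl lq.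
by rewrite (co_comp Ff) //; exact: sobj_quo.
Qed.

Lemma cocomp_sysmor (X Y : filtered (level R m)) (phi : {linear fmod X -> fmod Y}) :
    sobj (n := m.+1) X -> sobj (n := m.+1) Y -> @ismor R m.+1 X Y phi ->
  sysmor (N := cosys F Y) (M := cosys F X) (fun i' i => maps_into phi i' i)
    (fun k j => maps_into phi k j) (@cocomp _ _ _ F X Y (@canon R m.+1 X Y phi)).
Proof.
move=> sX sY mphi; have [oX _] := sX; have [oY _] := sY; split=> /=.
- by move=> i; exact: ismor_lower.
- by move=> k; exact: ismor_upper.
- by move=> i' i i2 i'i ii2; exact: maps_into_le i'i.
- by move=> i' i i2 i'i i2i; exact: maps_into_le i'i.
- by move=> k j k2 kj k2k; exact: maps_into_le kj.
- by move=> k j j2 kj jj2; exact: maps_into_le kj.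
- move=> i' k i j i'k ij i'i kj.
  have [chi chiP] := canon_comp_exists sX sY mphi i'k ij i'i kj.
  by exists (cmap F (canon chi)); exists (canon chi).
- by move=> i' k i j u i'k ij [h [_ _ i'i kj _] _].
move=> i' k i j u i2' k2 i2 j2 u2 i'k ij i2k2 ij2 [h hP <-] [h2 h2P <-].
move=> ii2' kk2 ii2 jj2 x.
have [chi [chi2 [mu [nu [[-> -> -> ->]]]]]] :=
  canon_comp_natural sX sY hP h2P ii2' kk2 ii2 jj2.
move=> [[mchi2 mchi mmu mnu] E].
by rewrite -!(co_comp Ff) ?E //; exact: sobj_quo.
Qed.

Lemma costep_functorial : cofunctorial (n := m.+1) (costep o F).
Proof.
split=> [X sX x|X Y Z phi psi sX sY sZ mphi mpsi x].
  have [oX _] := sX; have [fil _ _] := oX.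
  apply: (sysmor_id (cosys_law sX) (cocomp_sysmor sX sX (ismor_id oX))) => i j /= ij.
  exists (cmap F (canon (@idfun (mmod (fquo i j)) : {linear _ -> _}))).
    eexists; last reflexivity; split=> //; [exact: sub_mono|exact: sub_mono|].
    exists (@idfun (mmod (fquo i j))) => //; split.
      by move=> y z /= /(Defs.inc_inj fil) ->.
    by apply: ismor_id; apply: (sobj_quo sX ij).1.
  by move=> y; rewrite (co_id Ff) //; exact: sobj_quo.
have mcomp := ismor_comp sX sY sZ mphi mpsi.
apply: (sysmor_comp (cosys_law sZ) (cosys_law sY) (cosys_law sX) (cocomp_sysmor sY sZ mpsi)
  (cocomp_sysmor sX sY mphi) (cocomp_sysmor sX sZ mcomp)) => l' l i' k i j u v /= ij i'k l'l.
move=> [_ [_ _ i'i kj [chi' [ichi' mchi'] ->]] <-].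
move=> [_ [_ _ l'i' lk [chi [ichi mchi] ->]] <-].
exists (cmap F (canon (chi' \o chi : {linear _ -> _}))); last first.
  by move=> y /=; rewrite (co_comp Ff) //; exact: sobj_quo.
eexists; last reflexivity; split=> //; try exact: maps_into_trans; first last.
  exists (chi' \o chi) => //; split; first exact: induced_comp ichi'.
  by apply: ismor_comp => //; exact: sobj_quo.
Qed.

End ContravariantStep.
End Functoriality.

(** * Fourier transforms and duality *)

(** The induction hypothesis.  The composites F F' and F' F end in function
    spaces of the double dual.  This is why the transforms are considered on the
    duals as well, and why naturality is stated for a canonical map and for its
    transpose. *)
Record fourier_system (R : comPzRingType) (K : pzRingType) n (F : cofunctor K (level R n))
    (G : functor K (level R n)) (D : duality (level R n))
    (t : forall X, {linear cob F X -> vob G (dob D X)})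
    (t' : forall X, {linear vob G X -> cob F (dob D X)})
    (dl : forall X, mhom X (dob D (dob D X))) : Prop := FourierSystem {
  fs_co : cofunctorial F;
  fs_v : vfunctorial G;
  fs_bij : forall X, sobj X -> [/\ bijective (t X), bijective (t' X),
    bijective (t (dob D X)) & bijective (t' (dob D X))];
  fs_nat : forall (X Y : mob (level R n)) (phi : {linear mmod X -> mmod Y}),
    sobj X -> sobj Y -> ismor phi ->
    [/\ forall x, t X (cmap F (canon phi) x) =
          vmap G (dmor D (canon phi)) (t Y x),
        forall x, t' Y (vmap G (canon phi) x) =
          cmap F (dmor D (canon phi)) (t' X x),
        forall x, t (dob D Y) (cmap F (dmor D (canon phi)) x) =
          vmap G (dmor D (dmor D (canon phi))) (t (dob D X) x) &
        forall x, t' (dob D X) (vmap G (dmor D (canon phi)) x) =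
          cmap F (dmor D (dmor D (canon phi))) (t' (dob D Y) x)];
  fs_push : forall X, sobj X -> forall x, t (dob D X) (t' X x) = vmap G (dl X) x;
  fs_pull : forall X, sobj X -> forall x, cmap F (dl X) (t' (dob D X) (t X x)) = x }.

Section Step.
Variables (R : comPzRingType) (T : realType) (m : nat) (o : flavour).
Local Notation K := (T[i]).
Variables (F : cofunctor K (level R m)) (G : functor K (level R m)).
Variable D : duality (level R m).
Variable t : forall X, {linear cob F X -> vob G (dob D X)}.
Variable t' : forall X, {linear vob G X -> cob F (dob D X)}.
Variable dl : forall X, mhom X (dob D (dob D X)).
Arguments t : clear implicits.
Arguments t' : clear implicits.
Hypothesis fs : fourier_system t t' dl.

Section Systems.
Variable X : filtered (level R m).
Let le : fidx X -> fidx X -> Prop := fun i j => (i <= j)%O.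
Let ge : fidx X -> fidx X -> Prop := fun j i => (i <= j)%O.
Let X1 := dual_filtered D X.

(** The systems that define the function spaces of A, of its dual and of its
    double dual, written over the indices of A.  The first index of an entry is
    the smaller one in [co0], [v1] and [co2], the larger one in [v0], [co1] and
    [v2]. *)
Definition co0 i j k l :
  {linear cob F (@fquo _ _ X k l) ->
          cob F (@fquo _ _ X i j)} :=
  cmap F (fnat i j k l).
Definition co1 j i l k :
  {linear cob F (dob D (@fquo _ _ X k l)) ->
          cob F (dob D (@fquo _ _ X i j))} :=
  cmap F (dmor D (fnat k l i j)).
Definition co2 i j k l :
  {linear cob F (dob D (dob D (@fquo _ _ X k l))) ->
          cob F (dob D (dob D (@fquo _ _ X i j)))} :=
  cmap F (dmor D (dmor D (fnat i j k l))).
Definition v0 j i l k :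
  {linear vob G (@fquo _ _ X k l) ->
          vob G (@fquo _ _ X i j)} :=
  vmap G (fnat k l i j).
Definition v1 i j k l :
  {linear vob G (dob D (@fquo _ _ X k l)) ->
          vob G (dob D (@fquo _ _ X i j))} :=
  vmap G (dmor D (fnat i j k l)).
Definition v2 j i l k :
  {linear vob G (dob D (dob D (@fquo _ _ X k l))) ->
          vob G (dob D (dob D (@fquo _ _ X i j)))} :=
  vmap G (dmor D (dmor D (fnat k l i j))).


(** These equalities hold by conversion: duality reverses the order of the
    indices and exchanges the two of them, so the transforms are diagonal. *)
Lemma fourier_stepE : fourier_step o t X = diag_map le co0 v1 (fun i j => t (fquo i j)) o.
Proof. by []. Qed.
Lemma fourier_stepE' : fourier_step' o t' X = diag_map ge v0 co1 (fun j i => t' (fquo i j)) o.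
Proof. by []. Qed.
Lemma fourier_step_dualE : fourier_step o t X1 =
  diag_map ge co1 v2 (fun j i => t (dob D (fquo i j))) o.
Proof. by []. Qed.
Lemma fourier_step_dualE' : fourier_step' o t' X1 =
  diag_map le v1 co2 (fun i j => t' (dob D (fquo i j))) o.
Proof. by []. Qed.


Lemma delta_pullE : cmap (costep o F) (delta_step (D := D) dl X) =
  diag_map le co2 co0 (fun i j => cmap F (dl (fquo i j))) o.
Proof.
congr (ilim_map o _).
apply/functional_extensionality_dep => i'; apply/functional_extensionality_dep => k.
apply/functional_extensionality_dep => i; apply/functional_extensionality_dep => j.
apply/predeqP => w; split=> [[c cP <-]|cw]; first by case: cP.
by case: cw => i0 j0; exists (dl (fquo i0 j0)).
Qed.

Lemma delta_pushE : vmap (vstep o G) (delta_step (D := D) dl X) =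
  diag_map ge v0 v2 (fun j i => vmap G (dl (fquo i j))) o.
Proof.
congr (ilim_map o _).
apply/functional_extensionality_dep => j; apply/functional_extensionality_dep => i.
apply/functional_extensionality_dep => k; apply/functional_extensionality_dep => i'.
apply/predeqP => w; split=> [[c cP <-]|cw]; first by case: cP.
by case: cw => j0 i0; exists (dl (fquo i0 j0)).
Qed.

Hypothesis sX : sobj (n := m.+1) X.

Lemma law0 : bilaw (Bisys le co0).
Proof. exact: (cosys_law (fs_co fs) sX). Qed.
Lemma rlaw0 : bilaw (Bisys ge v0).
Proof. exact: (vsys_law (fs_v fs) sX). Qed.

Lemma t1_bij i j : le i j -> bijective (t (@fquo _ _ X i j)).
Proof. by move=> ij; have [] := fs_bij fs (sobj_quo sX ij). Qed.
Lemma s1_bij j i : ge j i -> bijective (t' (@fquo _ _ X i j)).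
Proof. by move=> ij; have [] := fs_bij fs (sobj_quo sX ij). Qed.
Lemma t2_bij j i : ge j i -> bijective (t (dob D (@fquo _ _ X i j))).
Proof. by move=> ij; have [] := fs_bij fs (sobj_quo sX ij). Qed.
Lemma s2_bij i j : le i j -> bijective (t' (dob D (@fquo _ _ X i j))).
Proof. by move=> ij; have [] := fs_bij fs (sobj_quo sX ij). Qed.

Lemma fnat_natural (i j k l : fidx X) :
    (i <= j)%O -> (k <= l)%O -> (i <= k)%O -> (j <= l)%O ->
  [/\ forall x, t _ (cmap F (fnat i j k l) x) = vmap G (dmor D (fnat i j k l)) (t _ x),
      forall x, t' _ (vmap G (fnat i j k l) x) = cmap F (dmor D (fnat i j k l)) (t' _ x),
      forall x, t _ (cmap F (dmor D (fnat i j k l)) x) =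
        vmap G (dmor D (dmor D (fnat i j k l))) (t _ x) &
      forall x, t' _ (vmap G (dmor D (fnat i j k l)) x) =
        cmap F (dmor D (dmor D (fnat i j k l))) (t' _ x)].
Proof.
move=> ij kl ik jl; have [oX _] := sX; have [chi [_ mchi -> _]] := fnatP oX ij kl ik jl.
by apply: (fs_nat fs) => //; exact: sobj_quo.
Qed.

Lemma t1_nat : diag_natural le co0 v1 (fun i j => t (fquo i j)).
Proof. by move=> i j k l ij kl ik jl; have [] := fnat_natural ij kl ik jl. Qed.
Lemma s1_nat : diag_natural ge v0 co1 (fun j i => t' (fquo i j)).
Proof. by move=> j i l k ij kl lj ik; have [] := fnat_natural kl ij ik lj. Qed.
Lemma t2_nat : diag_natural ge co1 v2 (fun j i => t (dob D (fquo i j))).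
Proof. by move=> j i l k ij kl lj ik; have [] := fnat_natural kl ij ik lj. Qed.
Lemma s2_nat : diag_natural le v1 co2 (fun i j => t' (dob D (fquo i j))).
Proof. by move=> i j k l ij kl ik jl; have [] := fnat_natural ij kl ik jl. Qed.

Lemma law1 : bilaw (Bisys le v1).
Proof. exact: (diag_iso_law law0 t1_nat t1_bij). Qed.
Lemma rlaw1 : bilaw (Bisys ge co1).
Proof. exact: (diag_iso_law rlaw0 s1_nat s1_bij). Qed.
Lemma law2 : bilaw (Bisys le co2).
Proof. exact: (diag_iso_law law1 s2_nat s2_bij). Qed.
Lemma rlaw2 : bilaw (Bisys ge v2).
Proof. exact: (diag_iso_law rlaw1 t2_nat t2_bij). Qed.

Lemma step_bij : [/\ bijective (fourier_step o t X), bijective (fourier_step' o t' X),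
  bijective (fourier_step o t X1) & bijective (fourier_step' o t' X1)].
Proof.
rewrite fourier_stepE fourier_stepE' fourier_step_dualE fourier_step_dualE'; split.
- exact: (diag_map_bij law0 t1_nat t1_bij).
- exact: (diag_map_bij rlaw0 s1_nat s1_bij).
- exact: (diag_map_bij rlaw1 t2_nat t2_bij).
- exact: (diag_map_bij law1 s2_nat s2_bij).
Qed.

Lemma step_push x : fourier_step o t X1 (fourier_step' o t' X x) =
  vmap (vstep o G) (delta_step (D := D) dl X) x.
Proof.
rewrite fourier_stepE' fourier_step_dualE delta_pushE.
apply: (diag_map_comp rlaw0 rlaw1 rlaw2 s1_nat t2_nat) => j i ij y.
by rewrite (fs_push fs) //; exact: sobj_quo.
Qed.

(** On each quotient delta^* is the inverse of F' F, which is natural. *)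
Lemma dl_nat : diag_natural le co2 co0 (fun i j => cmap F (dl (fquo i j))).
Proof.
move=> i j k l ij kl ik jl y.
have [f _ fK] := s2_bij kl; have [g _ gK] := t1_bij kl.
rewrite -[y]fK -[f y]gK /= -s2_nat // -t1_nat // !(fs_pull fs) //; exact: sobj_quo.
Qed.

Lemma step_pull x : cmap (costep o F) (delta_step (D := D) dl X)
  (fourier_step' o t' X1 (fourier_step o t X x)) = x.
Proof.
rewrite fourier_stepE fourier_step_dualE' delta_pullE.
pose w i j : {linear _ -> _} := t' (dob D (@fquo _ _ X i j)) \o t (@fquo _ _ X i j).
rewrite (diag_map_comp (w := w) law0 law1 law2 t1_nat s2_nat) //.
have wnat : diag_natural le co0 co2 w.
  by move=> i j k l ij kl ik jl y; rewrite /= t1_nat // s2_nat.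
rewrite (diag_map_comp (w := fun i j => idfun) law0 law2 law0 wnat dl_nat)
  ?(diag_map_id law0) //.
by move=> i j ij y /=; rewrite (fs_pull fs) //; exact: sobj_quo.
Qed.

End Systems.

Section Naturality.
Variables (X Y : filtered (level R m)) (phi : {linear fmod X -> fmod Y}).
Hypotheses (sX : sobj (n := m.+1) X) (sY : sobj (n := m.+1) Y).
Hypothesis mphi : @ismor R m.+1 X Y phi.
Let h0 : fhom X Y := @canon R m.+1 X Y phi.
Let h1 := dual_fhom D h0.
Let h2 := dual_fhom D h1.

(** The components of the transposes of a canonical map are images of those of
    the map itself, which come from morphisms between strong quotients. *)
Lemma hcomp_natural i' k i j (h : mhom (fquo i' k) (fquo i j)) :
    @hcomp _ _ X Y h0 i' k i j h ->
  [/\ forall x, t _ (cmap F h x) = vmap G (dmor D h) (t _ x),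
      forall x, t' _ (vmap G h x) = cmap F (dmor D h) (t' _ x),
      forall x, t _ (cmap F (dmor D h) x) = vmap G (dmor D (dmor D h)) (t _ x) &
      forall x, t' _ (vmap G (dmor D h) x) = cmap F (dmor D (dmor D h)) (t' _ x)].
Proof.
move=> [i'k ij _ _ [chi [_ mchi] ->]].
by apply: (fs_nat fs) => //; exact: sobj_quo.
Qed.

Lemma transport_t1 : determined o (@vcomp _ _ _ G _ _ h1) /\
  forall x, vmap (vstep o G) h1 (fourier_step o t Y x) =
    fourier_step o t X (cmap (costep o F) h0 x).
Proof.
apply: (transport (c := @cocomp _ _ _ F X Y h0) (c' := @vcomp _ _ _ G _ _ h1)
  (law0 sY) (law0 sX) (t1_nat sY) (t1_nat sX) (t1_bij sY) (t1_bij sX)).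
- move=> i' k i j _ _ w [h hP <-]; have [nh _ _ _] := hcomp_natural hP.
  by exists (vmap G (dmor D h)) => // ; exists (dmor D h) => //; exists h.
- move=> i' k i j _ _ w [_ [h hP <-] <-]; have [nh _ _ _] := hcomp_natural hP.
  by exists (cmap F h) => //; exists h.
exact: (sysmor_determined (law0 sY) (law0 sX) (cocomp_sysmor (fs_co fs) sX sY mphi) o).
Qed.

Lemma transport_s1 : determined o (@cocomp _ _ _ F _ _ h1) /\
  forall x, cmap (costep o F) h1 (fourier_step' o t' X x) =
    fourier_step' o t' Y (vmap (vstep o G) h0 x).
Proof.
apply: (transport (c := @vcomp _ _ _ G X Y h0) (c' := @cocomp _ _ _ F _ _ h1)
  (rlaw0 sX) (rlaw0 sY) (s1_nat sX) (s1_nat sY) (s1_bij sX) (s1_bij sY)).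
- move=> i' k i j _ _ w [h hP <-]; have [_ nh _ _] := hcomp_natural hP.
  by exists (cmap F (dmor D h)) => // ; exists (dmor D h) => //; exists h.
- move=> i' k i j _ _ w [_ [h hP <-] <-]; have [_ nh _ _] := hcomp_natural hP.
  by exists (vmap G h) => //; exists h.
exact: (sysmor_determined (rlaw0 sX) (rlaw0 sY) (vcomp_sysmor (fs_v fs) sX sY mphi) o).
Qed.

Lemma transport_t2 x : vmap (vstep o G) h2 (fourier_step o t (dual_filtered D X) x) =
  fourier_step o t (dual_filtered D Y) (cmap (costep o F) h1 x).
Proof.
apply: (transport (c := @cocomp _ _ _ F _ _ h1) (c' := @vcomp _ _ _ G _ _ h2)
  (rlaw1 sX) (rlaw1 sY) (t2_nat sX) (t2_nat sY) (t2_bij sX) (t2_bij sY) _ _ _).2.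
- move=> i' k i j _ _ w [_ [h hP <-] <-]; have [_ _ nh _] := hcomp_natural hP.
  exists (vmap G (dmor D (dmor D h))) => //; exists (dmor D (dmor D h)) => //.
  by exists (dmor D h) => //; exists h.
- move=> i' k i j _ _ w [_ [_ [h hP <-] <-] <-]; have [_ _ nh _] := hcomp_natural hP.
  by exists (cmap F (dmor D h)) => //; exists (dmor D h) => //; exists h.
exact: transport_s1.1.
Qed.

Lemma transport_s2 x : cmap (costep o F) h2 (fourier_step' o t' (dual_filtered D Y) x) =
  fourier_step' o t' (dual_filtered D X) (vmap (vstep o G) h1 x).
Proof.
apply: (transport (c := @vcomp _ _ _ G _ _ h1) (c' := @cocomp _ _ _ F _ _ h2)
  (law1 sY) (law1 sX) (s2_nat sY) (s2_nat sX) (s2_bij sY) (s2_bij sX) _ _ _).2.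
- move=> i' k i j _ _ w [_ [h hP <-] <-]; have [_ _ _ nh] := hcomp_natural hP.
  exists (cmap F (dmor D (dmor D h))) => //; exists (dmor D (dmor D h)) => //.
  by exists (dmor D h) => //; exists h.
- move=> i' k i j _ _ w [_ [_ [h hP <-] <-] <-]; have [_ _ _ nh] := hcomp_natural hP.
  by exists (vmap G (dmor D h)) => //; exists (dmor D h) => //; exists h.
exact: transport_t1.1.
Qed.

End Naturality.

Lemma fourier_system_step : @fourier_system R K m.+1 (costep o F) (vstep o G) (dual_step D)
  (fourier_step o t) (fourier_step' o t') (delta_step (D := D) dl).
Proof.
split.
- exact: costep_functorial (fs_co fs).
- exact: vstep_functorial (fs_v fs).
- exact: step_bij.
- move=> X Y phi sX sY mphi; split=> x; apply/esym.
  + exact: (transport_t1 sX sY mphi).2.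
  + exact: (transport_s1 sX sY mphi).2.
  + exact: (transport_t2 sX sY mphi).
  + exact: (transport_s2 sX sY mphi).
- exact: step_push.
- exact: step_pull.
Qed.

End Step.

(** * The group Q/Z and its character exp(2 pi i x) *)
Section RationalsModZ.

Definition qz (q : rat) : QmodZ := (\pi_QmodZ q)%qT.

Fact qz_zmod : zmod_morphism qz.
Proof. by move=> x y; rewrite /qz !piE. Qed.
HB.instance Definition _ := GRing.isZmodMorphism.Build rat QmodZ qz qz_zmod.

Lemma qz_repr x : qz (repr x) = x.
Proof. by rewrite /qz reprK. Qed.

Lemma qz_eq x y : qz x = qz y <-> exists n : int, x = y + n%:~R.
Proof.
rewrite /qz; split.
  move/eqP; rewrite -Quotient.idealrBE => /Num.int_num_subproof[n e].
  by exists n; rewrite -e addrC subrK.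
move=> [n ->]; apply/eqP; rewrite -Quotient.idealrBE addrC addKr.
by apply/Num.int_num_subproof; exists n.
Qed.

End RationalsModZ.

Section Exponential.
Variable T : realType.
Local Notation C := (T[i]).

Lemma periodic_int (U V : zmodType) (f : U -> V) (p : U) : periodic f p ->
  forall (n : int) a, f (a + p *~ n) = f a.
Proof.
move=> fp [n|n] a; first by rewrite -pmulrn; exact: periodicn.
by rewrite NegzE mulrNz -pmulrn -[in RHS](subrK (p *+ n.+1) a) (periodicn fp).
Qed.

(** Another representative changes the angle by a multiple of 2 pi. *)
Lemma expi_qz q : expi T (qz q) =
  (cos (2 * pi * ratr q : T) +i* sin (2 * pi * ratr q : T))%C.
Proof.
rewrite /expi; have [n ->] : exists n : int, repr (qz q) = q + n%:~R.
  by apply/qz_eq; rewrite qz_repr.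
have e : 2 * pi * ratr (q + n%:~R) = 2 * pi * ratr q + (pi *+ 2) *~ n :> T.
  by rewrite rmorphD /= ratr_int mulrDr mulrzr mulr2n mulrDl mul1r.
by rewrite e (periodic_int (@sinD2pi T)) (periodic_int (@cosD2pi T)).
Qed.

Lemma expiD x y : expi T (x + y) = expi T x * expi T y.
Proof.
rewrite -[x]qz_repr -[y]qz_repr -raddfD /= !expi_qz rmorphD /= mulrDr cosD sinD.
apply/eqP; rewrite eq_complex /=; apply/andP; split; apply/eqP; ring.
Qed.

Lemma expi0 : expi T 0 = 1.
Proof. by rewrite -(raddf0 qz) expi_qz rmorph0 mulr0 cos0 sin0. Qed.

Lemma expi_eq1 x : expi T x = 1 -> x = 0.
Proof.
rewrite -[x]qz_repr; set q := repr x; rewrite -(raddf0 qz) => e1; apply/qz_eq.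
exists (Num.floor q); rewrite add0r; pose r := q - (Num.floor q)%:~R.
have qr : qz q = qz r by apply/qz_eq; exists (Num.floor q); rewrite subrK.
have r0 : 0 <= r by rewrite subr_ge0 Num.Theory.floor_le.
have r1 : r < 1 by rewrite ltrBlDl; have := Num.Theory.floorD1_gt q; rewrite rmorphD.
have [rp|] := ltP 0 r; last by move=> rn; apply/eqP; rewrite -subr_eq0 eq_le rn r0.
move: e1; rewrite qr expi_qz => -[+ _].
have -> : 2 * pi * ratr r = (pi * ratr r) *+ 2 :> T by rewrite mulr2n; ring.
have sp : 0 < sin (pi * ratr r) :> T.
  apply: sin_gt0_pi; rewrite mulr_gt0 ?pi_gt0 ?ltr0q //=.
  by rewrite gtr_pMr ?pi_gt0 // -(rmorph1 (ratr : rat -> T)) ltr_rat.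
(* cos (2 t) = 1 forces sin t = 0, while t = pi r lies strictly between 0 and pi. *)
rewrite cos_mulr2n => c1.
have := cos2Dsin2 (pi * ratr r : T); have : 0 < sin (pi * ratr r : T) ^+ 2 by exact: exprn_gt0.
move=> h1 h2; exfalso; move: c1 h1 h2; move: (cos _) (sin _) => c s.
by clear => *; lra.
Qed.

End Exponential.

(** * Characters of finite abelian groups *)
Section FiniteGroups.
Variable A : zmodType.

Definition elems : seq A := fset_set [set: A].

Hypothesis finA : finite_set [set: A].

Lemma elems_uniq : uniq elems.
Proof. exact: fset_uniq. Qed.

Lemma mem_elems a : a \in elems.
Proof. by rewrite /elems in_fset_set //; exact: mem_set. Qed.

(** Among the multiples 0, a, ..., N a, with N the order of the group, two coincide. *)
Lemma torsion (a : A) : exists d, [/\ (0 < d)%N, (d <= size elems)%N & a *+ d = 0].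
Proof.
pose s := [seq a *+ i | i <- iota 0 (size elems).+1].
have /(uniqPn 0)[i [j [ij js]]] : ~~ uniq s.
  apply/negP => us; have := uniq_leq_size us (fun x _ => mem_elems x).
  by rewrite size_map size_iota ltnn.
rewrite size_map size_iota in js; have is' := ltn_trans ij js.
rewrite !(nth_map 0%N) ?size_iota // !nth_iota // !add0n => e.
exists (j - i)%N; split; first by rewrite subn_gt0.
  by rewrite leq_subLR; move: js; rewrite ltnS => /leq_trans -> //; exact: leq_addl.
by rewrite mulrnBr ?(ltnW ij) // e subrr.
Qed.

(** A character of the subgroup [H]; the values of [chi] off [H] are arbitrary. *)
Record partial_char (H : A -> Prop) (chi : A -> QmodZ) : Prop := PartialChar {
  pchar0 : H 0;
  pcharB : forall x y, H x -> H y -> H (x - y);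
  pcharD : forall x y, H x -> H y -> chi (x + y) = chi x + chi y }.

Section Partial.
Variables (H : A -> Prop) (chi : A -> QmodZ).
Hypothesis Hchi : partial_char H chi.

Lemma pchar_mulz x (k : int) : H x -> H (x *~ k) /\ chi (x *~ k) = chi x *~ k.
Proof.
move=> Hx; have chi0 : chi 0 = 0.
  have := pcharD Hchi (pchar0 Hchi) (pchar0 Hchi).
  by rewrite addr0 => /eqP; rewrite -subr_eq0 opprD addNKr oppr_eq0 => /eqP.
have HN y : H y -> H (- y) by rewrite -[- y]add0r; exact/(pcharB Hchi)/(pchar0 Hchi).
have chiN y : H y -> chi (- y) = - chi y.
  move=> Hy; apply/eqP; rewrite -subr_eq0 opprK addrC -(pcharD Hchi Hy (HN y Hy)).
  by rewrite subrr chi0.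
have HD y z : H y -> H z -> H (y + z).
  by move=> Hy Hz; rewrite -[z]opprK; apply: (pcharB Hchi) => //; exact: HN.
have Hn n : H (x *+ n) /\ chi (x *+ n) = chi x *+ n.
  elim: n => [|n [IH IHe]]; first by rewrite !mulr0n; split=> //; exact: pchar0 Hchi.
  by rewrite !mulrS (pcharD Hchi) // IHe; split=> //; exact: HD.
case: k => n; first by rewrite -!pmulrn.
have [Hm e] := Hn n.+1.
by rewrite NegzE !mulrNz -!pmulrn chiN // e; split=> //; exact: HN.
Qed.

Lemma pchar_order x : exists n, [/\ (0 < n)%N, H (x *+ n) &
  forall k : int, H (x *~ k) -> exists q : int, k = q * n%:Z].
Proof.
have [d [d0 _ xd]] := torsion x.
have ex : exists n, (0 < n)%N && `[< H (x *+ n) >].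
  by exists d; rewrite d0 xd; apply/asboolP; exact: pchar0 Hchi.
have [n /andP[n0 /asboolP Hn] nmin] := ex_minnP ex.
exists n; split=> // k Hk; exists (k %/ n)%Z.
have e := divz_eq k n; rewrite {1}e.
suff -> : (k %% n)%Z = 0 by rewrite addr0.
have n0' : (n : int) != 0 by rewrite -lt0n.
have := modz_ge0 k n0'; have := ltz_pmod k (n0 : (0 < n :> int)).
case: (k %% n)%Z e => // r e rn _; case: r => // r in e rn *.
have : H (x *+ r.+1).
  have -> : x *+ r.+1 = x *~ k - (x *+ n) *~ (k %/ n)%Z.
    by rewrite {1}e mulrzDr [X in x *~ X]mulrC mulrzA -!pmulrn addrC addKr.
  by apply: (pcharB Hchi) => //; exact: (pchar_mulz _ Hn).1.
move=> Hr; have := nmin r.+1; rewrite (introT (asboolP _) Hr) => /(_ isT).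
by rewrite leqNgt -ltz_nat rn.
Qed.

(** The character is extended to the subgroup generated by [H] and [x] by
    h + k x |-> chi h + k y; the hypothesis makes this well defined. *)
Lemma pchar_adjoin x y : (forall k : int, H (x *~ k) -> chi (x *~ k) = y *~ k) ->
  exists H' chi', [/\ partial_char H' chi',
    forall h, H h -> H' h /\ chi' h = chi h, H' x & chi' x = y].
Proof.
move=> xy; pose Q z v := exists h k, [/\ H h, z = h + x *~ k & v = chi h + y *~ k].
have HB := pcharB Hchi; have HD u v : H u -> H v -> H (u + v).
  by move=> Hu Hv; rewrite -[v]opprK -[- v]add0r; apply/HB/HB/Hv/(pchar0 Hchi).
have Qf z v v' : Q z v -> Q z v' -> v = v'.
  move=> [h [k [Hh -> ->]]] [h' [k' [Hh' e ->]]].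
  have e' : x *~ (k - k') = h' - h.
    by rewrite mulrzBr; apply/eqP; rewrite subr_eq addrAC eq_sym subr_eq -e addrC.
  have Hkk : H (x *~ (k - k')) by rewrite e'; exact: HB.
  have e2 := xy _ Hkk; rewrite e' in Hkk e2; rewrite mulrzBr in e2.
  by rewrite -[h'](subrK h) (pcharD Hchi Hkk Hh) e2 addrAC subrK addrC.
have QB z v z' v' : Q z v -> Q z' v' -> Q (z - z') (v - v').
  move=> [h [k [Hh -> ->]]] [h' [k' [Hh' -> ->]]]; exists (h - h'), (k - k').
  have Hhh := HB _ _ Hh Hh'; split=> //; first by rewrite mulrzBr opprD addrACA.
  by rewrite -{1}(subrK h' h) (pcharD Hchi Hhh Hh') mulrzBr opprD addrACA addrK.
pose H' z := exists v, Q z v.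
pose chi' z := if pselect (H' z) is left e then projT1 (cid e) else 0.
have chi'P z v : Q z v -> chi' z = v.
  move=> zv; rewrite /chi'; case: pselect => [e|[]]; last by exists v.
  exact: Qf (projT2 (cid e)) zv.
have Qh h : H h -> Q h (chi h) by exists h, 0; rewrite !mulr0z !addr0.
have Qx : Q x y.
  exists 0, 1; rewrite !mulr1z !add0r; split=> //; first exact: pchar0 Hchi.
  by have := (pchar_mulz 0 (pchar0 Hchi)).2; rewrite mul0rz mulr0z => ->; rewrite add0r.
exists H', chi'; split; last exact: chi'P.
- split; first by exists (chi 0); exact/Qh/(pchar0 Hchi).
    by move=> u v [u' uu'] [v' vv']; exists (u' - v'); exact: QB.
  move=> u v [u' uu'] [v' vv']; rewrite (chi'P _ _ uu') (chi'P _ _ vv'); apply: chi'P.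
  have Q0 : Q 0 0 by have := QB _ _ _ _ uu' uu'; rewrite !subrr.
  by have := QB _ _ _ _ uu' (QB _ _ _ _ Q0 vv'); rewrite !sub0r !opprK.
- by move=> h Hh; split; [exists (chi h); exact: Qh|exact/chi'P/Qh].
- by exists y.
Qed.

End Partial.

(** If n x is the first positive multiple of [x] in [H], then [y] has to satisfy
    n y = chi (n x), and Q/Z is divisible. *)
Lemma pchar_value H chi x : partial_char H chi ->
  exists y, forall k : int, H (x *~ k) -> chi (x *~ k) = y *~ k.
Proof.
move=> Hchi; have [n [n0 Hn nP]] := pchar_order Hchi x.
exists (qz (repr (chi (x *+ n)) / n%:R)) => k /nP[q ->].
rewrite mulrC mulrzA -pmulrn (pchar_mulz Hchi q Hn).2 mulrzA -pmulrn -raddfMn /=.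
by rewrite -[_ / _ *+ n]mulr_natr divfK ?qz_repr // pnatr_eq0 -lt0n.
Qed.

Lemma pchar_extend H chi (s : seq A) : partial_char H chi ->
  exists H' chi', [/\ partial_char H' chi',
    forall h, H h -> H' h /\ chi' h = chi h & {in s, forall x, H' x}].
Proof.
elim: s H chi => [|x s IH] H chi Hchi; first by exists H, chi; split.
have [y xy] := pchar_value x Hchi.
have [H1 [chi1 [H1chi1 sub1 H1x _]]] := pchar_adjoin Hchi xy.
have [H2 [chi2 [H2chi2 sub2 H2s]]] := IH _ _ H1chi1.
exists H2, chi2; split=> //.
  by move=> h /sub1[/sub2[? <-] <-].
move=> z; rewrite inE => /orP[/eqP ->|]; last exact: H2s.
by have [] := sub2 _ H1x.
Qed.

(** On the subgroup generated by [a], of order n, the character that sends [a]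
    to 1/n does not kill [a]; it extends to the whole group. *)
Lemma separation (a : A) : a != 0 ->
  exists2 chi : A -> QmodZ, {morph chi : x y / x + y} & chi a != 0.
Proof.
move=> a0; pose H0 x := x = 0 :> A.
have HH0 : partial_char H0 (fun=> 0).
  by split=> // [x y -> ->|x y _ _]; rewrite /H0 ?subr0 ?addr0.
have [n [n0 Hn nP]] := pchar_order HH0 a.
have n1 : (1 < n)%N.
  by rewrite ltn_neqAle n0 andbT; apply: contraNneq a0 => n1; rewrite -n1 in Hn; apply/eqP.
have [k /nP[q ->]|H1 [chi1 [H1chi1 _ H1a chi1a]]] :=
    pchar_adjoin HH0 (x := a) (y := qz n%:R^-1).
  rewrite mulrC mulrzA -pmulrn -raddfMn /= -[n%:R^-1 *+ n]mulr_natr mulVf ?pnatr_eq0 -?lt0n //.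
  have -> : qz 1 = 0 by rewrite -(raddf0 qz); apply/qz_eq; exists 1; rewrite add0r.
  by rewrite mul0rz.
have [H2 [chi2 [H2chi2 sub2 H2s]]] := pchar_extend elems H1chi1.
exists chi2; first by move=> x y; apply: (pcharD H2chi2); exact/H2s/mem_elems.
rewrite (sub2 _ H1a).2 chi1a -(raddf0 qz); apply/eqP => /qz_eq[m].
rewrite add0r => e; have np : 0 < n%:R :> rat by rewrite ltr0n.
have : 0 < m%:~R :> rat by rewrite -e invr_gt0.
have : m%:~R < 1 :> rat by rewrite -e invf_lt1 // ltr1n.
by rewrite ltr0z ltrz1; case: m {e} => [[|m]|m].
Qed.

End FiniteGroups.

(** * Orthogonality of characters *)
Lemma sum_pred1_seq (V : nmodType) (I : eqType) (s : seq I) (a : I) (f : I -> V) :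
  uniq s -> a \in s -> \sum_(b <- s | b == a) f b = f a.
Proof.
by move=> us sa; rewrite big_mkcond (bigD1_seq a) //= eqxx big1 ?addr0 // => b /negbTE ->.
Qed.

Section FiniteSums.
Variables (A B : zmodType) (V : nmodType).
Hypotheses (finA : finite_set [set: A]) (finB : finite_set [set: B]).

Lemma sum_fset_set (P : pred A) (f : A -> V) :
  \sum_(a <- fset_set [set a | P a]) f a = \sum_(a <- elems A | P a) f a.
Proof.
rewrite -[RHS]big_filter; apply: perm_big; apply: uniq_perm.
- exact: fset_uniq.
- exact/filter_uniq/elems_uniq.
move=> a; rewrite in_fset_set; last exact: sub_finite_set finA.
rewrite mem_filter mem_elems // andbT; apply/idP/idP; first by move/set_mem.
by move=> Pa; apply: mem_set.
Qed.

Lemma sum_fibers (phi : A -> B) (P : pred B) (f : A -> B -> V) :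
  \sum_(b <- elems B | P b) \sum_(a <- elems A | phi a == b) f a b =
  \sum_(a <- elems A | P (phi a)) f a (phi a).
Proof.
rewrite (exchange_big_dep (fun a => P (phi a))) /=; last by move=> b a Pb /eqP ->.
apply: eq_bigr => a Pa.
rewrite -[RHS](sum_pred1_seq (f a) (elems_uniq B) (mem_elems finB (phi a))).
apply: eq_bigl => b; rewrite eq_sym; case: eqP => [->|_]; last by rewrite andbF.
by rewrite Pa.
Qed.

End FiniteSums.

Section Orthogonality.
Variables (T : realType) (B : zmodType).
Hypothesis finB : finite_set [set: B].

Lemma sum_expi_trivial (f : B -> QmodZ) : (forall b, f b = 0) ->
  \sum_(b <- elems B) expi T (f b) = (size (elems B))%:R.
Proof.
move=> f0; rewrite (eq_bigr (fun=> 1)) => [|b _]; last by rewrite f0 expi0.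
by rewrite big_const_seq count_predT iter_addr_0.
Qed.

(** Translating the summation variable by [b0] multiplies the sum by
    exp(2 pi i f(b0)), which is not 1. *)
Lemma sum_expi_nontrivial (f : B -> QmodZ) b0 : {morph f : x y / x + y} ->
  f b0 != 0 -> \sum_(b <- elems B) expi T (f b) = 0.
Proof.
move=> fD fb0.
have shift : perm_eq [seq b + b0 | b <- elems B] (elems B).
  apply: uniq_perm; [by rewrite map_inj_uniq ?elems_uniq//; exact: addIr|exact: elems_uniq|].
  move=> b; rewrite mem_elems //; apply/mapP; exists (b - b0); first exact: mem_elems.
  by rewrite subrK.
set S := LHS; have SE : S = S * expi T (f b0).
  rewrite {1}/S -(perm_big _ shift) big_map mulr_suml; apply: eq_bigr => b _.
  by rewrite fD expiD.
have /eqP : S * (1 - expi T (f b0)) = 0 by rewrite mulrBr mulr1 -SE subrr.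
rewrite mulf_eq0 subr_eq0 => /orP[/eqP //|/eqP e].
by case/negP: fb0; apply/eqP; apply: (@expi_eq1 T).
Qed.

End Orthogonality.

Section Characters.
Variables (R : comPzRingType) (A : lmodType R).
Implicit Types (alpha : character A).

Lemma char0 alpha : alpha 0 = 0.
Proof. by apply: (addrI (alpha 0)); rewrite -charD !addr0. Qed.

Lemma charN alpha a : alpha (- a) = - alpha a.
Proof. by apply: (addrI (alpha a)); rewrite -charD !subrr char0. Qed.

Lemma charMn alpha a n : alpha (a *+ n) = alpha a *+ n.
Proof. by elim: n => [|n IH]; rewrite ?mulr0n ?char0 // !mulrS charD IH. Qed.

Hypothesis finA : finite_set [set: A].
Local Notation N := (size (elems A))`!.

(** The factorial of the order of the module kills all its elements, hence all
    the values of its characters. *)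
Lemma char_values alpha a : exists k : 'I_N.-1.+1, alpha a = qz (k%:R / N%:R).
Proof.
have N0 : N%:R != 0 :> rat by rewrite pnatr_eq0 -lt0n fact_gt0.
have : alpha a *+ N = 0.
  have [d [d0 dn ad]] := torsion finA a.
  have /dvdnP[q ->] : (d %| N)%N by rewrite dvdn_fact // d0 dn.
  by rewrite mulnC mulrnA -charMn ad char0 mul0rn.
rewrite -[alpha a]qz_repr; set q := repr _; rewrite -raddfMn -(raddf0 qz) /=.
move=> /qz_eq[m]; rewrite add0r => qm; rewrite -[q *+ _]mulr_natr in qm.
have Nz : (N : int) != 0 by rewrite -lt0n fact_gt0.
have := modz_ge0 m Nz; have := ltz_pmod m (fact_gt0 _ : (0 < N :> int)).
have := divz_eq m N; case: (m %% N)%Z => // k e kN _.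
have kN' : (k < N.-1.+1)%N by rewrite prednK ?fact_gt0.
exists (Ordinal kN'); apply/qz_eq; exists (m %/ N)%Z.
apply: (mulIf N0); rewrite mulrDl divfK // qm {1}e rmorphD rmorphM /= addrC.
by rewrite !pmulrn.
Qed.

(** A character is determined by the finitely many numerators of its values. *)
Lemma finite_character : finite_set [set: character A].
Proof.
pose n := size (elems A).
pose P (phi : {ffun 'I_n -> 'I_N.-1.+1}) alpha :=
  forall i : 'I_n, alpha (nth 0 (elems A) i) = qz ((phi i)%:R / N%:R).
pose g phi := if pselect (exists alpha, P phi alpha) is left e
  then projT1 (cid e) else 0.
apply: (@sub_finite_set _ _ (g @` setT)); last exact/finite_image/finite_finset.
move=> alpha _.
pose phi := [ffun i : 'I_n => projT1 (cid (char_values alpha (nth 0 (elems A) i)))].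
have Pphi : P phi alpha.
  by move=> i; rewrite ffunE; exact: projT2 (cid (char_values alpha (nth 0 (elems A) i))).
exists phi => //; rewrite /g; case: pselect => [e|[]]; last by exists alpha.
have gP := projT2 (cid e); apply: characterP => a.
have an : (index a (elems A) < n)%N by rewrite index_mem mem_elems.
have := gP (Ordinal an); have := Pphi (Ordinal an); rewrite /= nth_index ?mem_elems //.
by move=> -> ->.
Qed.

Lemma char_separation (a : A) : a != 0 -> exists alpha, alpha a != 0.
Proof.
by move=> /(separation finA)[f fD fa]; exists (Character fD).
Qed.

Section Real.
Variable T : realType.

Lemma sum_expi_eval (a : A) : \sum_(alpha <- elems (character A)) expi T (alpha a) =
  if a == 0 then (size (elems (character A)))%:R else 0.
Proof.
have [->|/char_separation[alpha aa]] := eqVneq a 0.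
  by rewrite sum_expi_trivial // => alpha; rewrite char0.
exact: (@sum_expi_nontrivial T _ finite_character (fun alpha => alpha a) alpha).
Qed.

Lemma sum_expi_char alpha : \sum_(a <- elems A) expi T (alpha a) =
  if alpha == 0 then (size (elems A))%:R else 0.
Proof.
have [->|alpha0] := eqVneq alpha 0; first by rewrite sum_expi_trivial.
have [a aa] : exists a, alpha a != 0; last first.
  exact: (sum_expi_nontrivial T finA (@charD _ _ alpha) aa).
apply: contrapT => na; case/eqP: alpha0; apply: characterP => a; apply/eqP.
by apply: contrapT => /negP aa; apply: na; exists a.
Qed.

(** The sum of exp(2 pi i alpha(a)) over all pairs (a, alpha), computed in either
    order: only a = 0 contributes in the one, only alpha = 0 in the other. *)
Lemma size_character : size (elems (character A)) = size (elems A).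
Proof.
have e : \sum_(a <- elems A) \sum_(alpha <- elems (character A)) expi T (alpha a) =
  \sum_(alpha <- elems (character A)) \sum_(a <- elems A) expi T (alpha a).
  exact: exchange_big.
move: e; rewrite (eq_bigr _ (fun a _ => sum_expi_eval a)).
rewrite [in RHS](eq_bigr _ (fun a _ => sum_expi_char a)) -!big_mkcond /=.
rewrite !sum_pred1_seq ?elems_uniq ?mem_elems //; last exact: finite_character.
by move=> /eqP; rewrite eqr_nat => /eqP.
Qed.

End Real.
End Characters.

(** * The inversion formula for finite modules *)
Section FiniteInversion.
Variables (R : comPzRingType) (T : realType) (A : lmodType R).
Hypothesis finA : finite_set [set: A].
Local Notation C := (T[i]).

Lemma evaluation_inj : injective (@evaluation R A).
Proof.
move=> a b ab; apply/eqP; rewrite -subr_eq0; apply: contrapT => /negP.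
move=> /(char_separation finA)[alpha]; rewrite charD charN.
have -> : alpha a = alpha b := congr1 (fun g : character _ => g alpha) ab.
by rewrite subrr eqxx.
Qed.

(** An injection between finite sets of the same size. *)
Lemma evaluation_surj gamma : exists a, gamma = @evaluation R A a.
Proof.
have finA1 := finite_character finA.
have us : uniq [seq @evaluation R A a | a <- elems A].
  by rewrite map_inj_uniq ?elems_uniq //; exact: evaluation_inj.
have sub : {subset [seq @evaluation R A a | a <- elems A] <= elems (character (character A))}.
  by move=> x _; apply: mem_elems; exact: finite_character.
have le : (size (elems (character (character A))) <=
    size [seq @evaluation R A a | a <- elems A])%N.
  by rewrite size_map (size_character finA1 T) (size_character finA T).
have [_ e] := uniq_min_size us sub le.
have : gamma \in elems (character (character A)) by apply: mem_elems; exact: finite_character.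
by rewrite -e => /mapP[a _ ->]; exists a.
Qed.

Lemma evaluation_bij : bijective (@evaluation R A).
Proof.
pose g gamma := projT1 (cid (evaluation_surj gamma)).
have gK gamma : evaluation (g gamma) = gamma.
  by rewrite -(projT2 (cid (evaluation_surj gamma))).
by exists g => // a; apply: evaluation_inj; rewrite gK.
Qed.

(** Orthogonality leaves only the term b = a; [c b] is a - b or b - a. *)
Lemma sum_chars (f : A -> C) (c : A -> A) a : (forall b, (c b == 0) = (b == a)) ->
  \sum_(alpha <- elems (character A)) \sum_(b <- elems A) f b * expi T (alpha (c b)) =
  f a * (size (elems A))%:R.
Proof.
move=> ca; rewrite exchange_big /=.
rewrite (eq_bigr (fun b => if b == a then f b * (size (elems A))%:R else 0)).
  by rewrite -big_mkcond /= sum_pred1_seq ?elems_uniq ?mem_elems.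
move=> b _; rewrite -mulr_sumr (sum_expi_eval finA) ca size_character //.
by case: eqP; rewrite ?mulr0.
Qed.

Lemma size_elems_neq0 : (size (elems A))%:R != 0 :> C.
Proof.
by rewrite pnatr_eq0 -lt0n; have := mem_elems finA 0; case: (elems A).
Qed.

Lemma fourier0K (f : A -> C^o) a :
  fourier0' (fourier0 f) (@evaluation R A a) = f a.
Proof.
rewrite /fourier0' /fourier0.
transitivity ((size (elems A))%:R^-1 * (\sum_(alpha <- elems (character A))
    \sum_(b <- elems A) (f b : C) * expi T (alpha (a - b)))).
  rewrite mulr_sumr; apply: eq_bigr => alpha _.
  rewrite -mulrA mulr_suml; congr (_ * _); apply: eq_bigr => b _.
  by rewrite charD charN addrC expiD mulrA.
rewrite (sum_chars _ (a := a)) => [|b].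
  by rewrite mulrCA mulVf ?mulr1 //; exact: size_elems_neq0.
by rewrite subr_eq0 eq_sym.
Qed.

Lemma fourier0K' (f : A -> C^o) a :
  fourier0 (fourier0' f) (@evaluation R A a) = f a.
Proof.
rewrite /fourier0' /fourier0.
transitivity ((size (elems (character A)))%:R^-1 * (\sum_(alpha <- elems (character A))
    \sum_(b <- elems A) (f b : C) * expi T (alpha (b - a)))).
  congr (_ * _); apply: eq_bigr => alpha _.
  rewrite mulr_suml; apply: eq_bigr => b _.
  by rewrite charD charN expiD mulrA.
rewrite (sum_chars _ (a := a)) => [|b]; last exact: subr_eq0.
by rewrite (size_character finA T) mulrCA mulVf ?mulr1 //; exact: size_elems_neq0.
Qed.

End FiniteInversion.

Section FiniteFunctors.
Variables (R : comPzRingType) (T : realType).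
Implicit Types A B D : lmodType R.
Local Notation C := (T[i]).

Definition finmod A := finite_set [set: A].

Lemma pushforwardE A B (phi : A -> B) (f : A -> C^o) b : finmod A ->
  pushforward phi f b = \sum_(a <- elems A | phi a == b) f a.
Proof.
move=> finA; rewrite -(sum_fset_set finA); congr (\sum_(a <- _ ) _).
by congr (enum_fset (fset_set _)); apply/seteqP; split=> a /= /eqP.
Qed.

Lemma pushforward_id A (f : A -> C^o) : finmod A -> pushforward id f = f.
Proof.
move=> finA; apply/funext => a; rewrite pushforwardE //.
by rewrite sum_pred1_seq ?elems_uniq ?mem_elems.
Qed.

Lemma pushforward_comp A B D (phi : A -> B) (psi : B -> D) (f : A -> C^o) :
  finmod A -> finmod B ->
  pushforward (psi \o phi) f = pushforward psi (pushforward phi f).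
Proof.
move=> finA finB; apply/funext => d; rewrite !pushforwardE //.
rewrite (eq_bigr (fun b => \sum_(a <- elems A | phi a == b) f a)) => [|b _];
  last exact: pushforwardE.
by rewrite (sum_fibers finB phi (fun b => psi b == d) (fun a _ => f a)).
Qed.

Lemma pushforward_eval A (f : A -> C^o) a : finmod A ->
  pushforward (@evaluation R A) f (evaluation a) = f a.
Proof.
move=> finA; rewrite pushforwardE //.
rewrite (eq_bigl (pred1 a)) => [|b /=].
  by rewrite sum_pred1_seq ?elems_uniq ?mem_elems.
by apply/eqP/eqP => [/(evaluation_inj finA)|->].
Qed.

Lemma transpose_natural A B (phi : {linear A -> B}) a :
  transpose (transpose phi) (evaluation a) = evaluation (phi a).
Proof. exact: characterP. Qed.

Lemma fourier0'_natural A B (phi : {linear A -> B}) (f : A -> C^o) :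
  finmod A -> finmod B ->
  fourier0' (pushforward phi f) = pullback (transpose phi) (fourier0' f).
Proof.
move=> finA finB; apply/funext => beta; rewrite /fourier0' /pullback /=.
rewrite -[RHS](sum_fibers finB phi xpredT (fun a b => f a * expi T (beta b))).
apply: eq_bigr => b _; rewrite pushforwardE // -[RHS]mulr_suml.
by [].
Qed.

Lemma fourier0_injective A : finmod A -> injective (@fourier0 R T A).
Proof.
move=> finA f g fg; apply/funext => a.
by rewrite -(fourier0K finA f) fg fourier0K.
Qed.

Lemma fourier0'_injective A : finmod A -> injective (@fourier0' R T A).
Proof.
move=> finA f g fg; apply/funext => a.
by rewrite -(fourier0K' finA f) fg fourier0K'.
Qed.

(** A direct proof would count the extensions of characters along phi.  Instead,
    the inverse transform, whose naturality is a mere change of the order of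
    summation, is applied to both sides. *)
Lemma fourier0_natural A B (phi : {linear A -> B}) (f : B -> C^o) :
  finmod A -> finmod B ->
  fourier0 (pullback phi f) = pushforward (transpose phi) (fourier0 f).
Proof.
move=> finA finB; apply: (fourier0'_injective (finite_character finA)).
rewrite (fourier0'_natural (transpose phi) (fourier0 f) (finite_character finB)
  (finite_character finA)); apply/funext => gamma; have [a ->] := evaluation_surj T finA gamma.
by rewrite fourier0K // /pullback /= transpose_natural fourier0K.
Qed.

Lemma bij_comp_inj (X Y Z : Type) (f : X -> Y) (g : Y -> Z) :
  bijective (g \o f) -> injective g -> bijective f.
Proof.
by move=> [h hK hK'] gI; exists (h \o g) => [x|y]; [exact: hK|apply: gI; exact: hK'].
Qed.

(** The composite of the two transforms is the inverse of composition with the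
    evaluation isomorphism. *)
Lemma fourier0_bij A : finmod A -> bijective (@fourier0 R T A).
Proof.
move=> finA; apply: (@bij_comp_inj _ _ _ _ (@fourier0' R T (character A))); last first.
  exact/fourier0'_injective/finite_character.
have [g gK gK'] := evaluation_bij T finA.
exists (fun h => h \o @evaluation R A) => f; apply/funext => x /=; first exact: fourier0K.
by rewrite -[x]gK' fourier0K.
Qed.

Lemma fourier0'_bij A : finmod A -> bijective (@fourier0' R T A).
Proof.
move=> finA; apply: (@bij_comp_inj _ _ _ _ (@fourier0 R T (character A))); last first.
  exact/fourier0_injective/finite_character.
have [g gK gK'] := evaluation_bij T finA.
exists (fun h => h \o @evaluation R A) => f; apply/funext => x /=; first exact: fourier0K'.
by rewrite -[x]gK' fourier0K'.
Qed.

Lemma fourier_system_base : @fourier_system R C 0 (fun_pull R T) (fun_push R T) (dual0 R)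
  (fun A : lmodType R => @fourier0 R T A : {linear _ -> _})
  (fun A : lmodType R => @fourier0' R T A : {linear _ -> _})
  (fun A : lmodType R => @evaluation R A : {linear _ -> _}).
Proof.
split.
- by split.
- split=> [A [finA _] f|A B D phi psi [finA _] [finB _] [finD _] _ _ f].
    exact: pushforward_id.
  exact: pushforward_comp.
- move=> A [finA _]; have finA1 : finmod (character A) := finite_character finA.
  by split; [exact: fourier0_bij|exact: fourier0'_bij|
    exact: fourier0_bij|exact: fourier0'_bij].
- move=> A B phi [finA _] [finB _] _.
  have finA1 : finmod (character A) := finite_character finA.
  have finB1 : finmod (character B) := finite_character finB.
  by split=> f; [exact: fourier0_natural|exact: fourier0'_natural|
    exact: fourier0_natural|exact: fourier0'_natural].
- move=> A [finA _] f; apply/funext => gamma.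
  have [a ->] := evaluation_surj T finA gamma.
  by rewrite [RHS]pushforward_eval // [LHS]fourier0K'.
- move=> A [finA _] f; apply/funext => a; exact: fourier0K.
Qed.

End FiniteFunctors.

(** * The inversion formula *)
Section Main.
Variables (R : comPzRingType) (T : realType).

Lemma fourier_system_E n :
  fourier_system (fourierE (R := R) T (n := n)) (fourierEt' T (n := n)) (@delta R n).
Proof. by elim: n => [|n IH]; [exact: fourier_system_base|exact: fourier_system_step IH]. Qed.

Lemma fourier_system_Et n :
  fourier_system (fourierEt (R := R) T (n := n)) (fourierE' T (n := n)) (@delta R n).
Proof. by elim: n => [|n IH]; [exact: fourier_system_base|exact: fourier_system_step IH]. Qed.

Section FourierPair.
Variables (n : nat) (F : cofunctor (T[i]) (level R n)) (G : functor (T[i]) (level R n)).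
Variables (t : forall X, {linear cob F X -> vob G (dob (dual R n) X)})
          (t' : forall X, {linear vob G X -> cob F (dob (dual R n) X)}).
Hypothesis fs : fourier_system t t' (@delta R n).

Lemma push_natiso : v_natiso (delta_push G).
Proof.
split=> [X sX|X Y phi [sX sY [mphi _]] f].
  have [_ tX' tX _] := fs_bij fs sX.
  by apply: (eq_bij (bij_comp tX tX')) => x; exact: (fs_push fs).
rewrite /delta_push -!(fs_push fs) //.
have [_ n1 n2 _] := fs_nat fs sX sY mphi.
by rewrite n1 n2.
Qed.

(** delta^* is the inverse of the natural isomorphism F' F. *)
Lemma pull_natiso : co_natiso (delta_pull F).
Proof.
have bij X : sobj X -> bijective (t' (dob (dual R n) X) \o t X).
  by move=> sX; have [tX _ _ tX'] := fs_bij fs sX; exact: bij_comp.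
have dK X (sX : sobj X) x : delta_pull F X ((t' (dob (dual R n) X) \o t X) x) = x.
  exact: (fs_pull fs).
split=> [X sX|X Y phi [sX sY [mphi _]] f].
  have [g gK gK'] := bij X sX; exists (t' (dob (dual R n) X) \o t X) => x; last exact: dK.
  by rewrite -[x]gK' dK.
have [g gK gK'] := bij Y sY; rewrite -[f]gK' dK //.
have [n1 _ _ n2] := fs_nat fs sX sY mphi.
by rewrite -[RHS](dK X sX) /= n1 n2.
Qed.

End FourierPair.
End Main.

Theorem theorem5p1 (R : comPzRingType) (T : realType) (n : nat) :
  [/\ v_natiso (delta_push (spEt' R T n)) /\
        (forall (X : mob (level R n)) (f : vob (spEt' R T n) X), sobj X ->
          fourierE T (dob (dual R n) X) (fourierEt' T X f) =
          delta_push (spEt' R T n) X f),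
      co_natiso (delta_pull (spE R T n)) /\
        (forall (X : mob (level R n)) (f : cob (spE R T n) X), sobj X ->
          delta_pull (spE R T n) X
            (fourierEt' T (dob (dual R n) X) (fourierE T X f)) = f),
      v_natiso (delta_push (spE' R T n)) /\
        (forall (X : mob (level R n)) (f : vob (spE' R T n) X), sobj X ->
          fourierEt T (dob (dual R n) X) (fourierE' T X f) =
          delta_push (spE' R T n) X f) &
      co_natiso (delta_pull (spEt R T n)) /\
        (forall (X : mob (level R n)) (f : cob (spEt R T n) X), sobj X ->
          delta_pull (spEt R T n) X
            (fourierE' T (dob (dual R n) X) (fourierEt T X f)) = f)].
Proof.
have fE := @fourier_system_E R T n; have fEt := @fourier_system_Et R T n; split; split.
- exact: push_natiso fE.
- by move=> X f sX; exact: (fs_push fE).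
- exact: pull_natiso fE.
- by move=> X f sX; exact: (fs_pull fE).
- exact: push_natiso fEt.
- by move=> X f sX; exact: (fs_push fEt).
- exact: pull_natiso fEt.
- by move=> X f sX; exact: (fs_pull fEt).
Qed.
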